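(* $GI_5=SI_5$; that is, for every $A\in SI_5$ there exists a generalised edge $G_{xy}$ with $CP_5(G_{xy})=A$, and every open $5$-capacity of a generalised edge is an element of $SI_5$.
   Context: Graphs are finite and may have multiple edges. Intervals: $\mathbb{R}/5\mathbb{Z}$ is viewed as a circle of length $5$. For $a\neq b$ in $\mathbb{R}/5\mathbb{Z}$, $(a,b)$ denotes the open arc traversed clockwise (increasing direction) from $a$ to $b$, and $(x,x)=\mathbb{R}/5\mathbb{Z}\setminus\{x\}$. $I_5$ is the set of all $(a,b)$ with $a,b$ integers modulo $5$. A set $X\subseteq\mathbb{R}/5\mathbb{Z}$ is symmetric if $x\in X\iff -x\in X$. $SI_5$ is the family of all symmetric subsets of $\mathbb{R}/5\mathbb{Z}$ that are unions of (possibly no) elements of $I_5$; in particular $\emptyset\in SI_5$. Generalised edges: a generalised edge $G_{xy}$ is a graph $G$ with at least two vertices together with two distinct vertices $x,y$, its terminals. $G_{xy}^+$ is obtained from $G_{xy}$ by adding a new edge $e^+=xy$. The open $5$-capacity is $CP_5(G_{xy})=\{f(e^+): f \text{ is a modulo-}5\text{ flow in } G_{xy}^+ \text{ (for some orientation) with } f(e)\in(1,4) \text{ for every } e\in E(G)\}$, where a modulo-$5$ flow takes values in $\mathbb{R}/5\mathbb{Z}$ and satisfies conservation modulo $5$ at every vertex. An $A$-edge is a generalised edge with $CP_5=A$. A set $A\in SI_5$ is graphic if there exists an $A$-edge, and $GI_5\subseteq SI_5$ is the set of all graphic elements.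
   Formalization: That every open 5-capacity of a generalised edge is in SI_5 is stated only when the terminals x, y are joined by a path in G; without this it fails, since two isolated vertices have CP_5 = {0}, which is not a union of open arcs. *)

(* Defs.v *)
From HB Require Import structures.
From mathcomp Require Import all_boot all_order all_algebra.
From mathcomp Require Import boolp classical_sets reals.

Set Implicit Arguments.
Unset Strict Implicit.
Unset Printing Implicit Defensive.

Import Order.TTheory GRing.Theory Num.Theory.
Local Open Scope classical_set_scope.
Local Open Scope ring_scope.

Section Circle.
Variable R : realType.

Definition fiveZ : {pred R} := [pred x | x / 5 \is a Num.int].

Lemma fiveZ_zmod_closed : zmod_closed fiveZ.
Proof.
split=> [|x y]; rewrite !inE ?mul0r ?rpred0 // mulrBl => hx hy.
exact: rpredB.
Qed.

HB.instance Definition _ :=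
  GRing.isZmodClosed.Build R fiveZ fiveZ_zmod_closed.

(* The quotient group R/5Z. *)
Definition circle := Quotient.quot (fiveZ : zmodClosed R).

Definition to_circle (t : R) : circle := (\pi_circle t)%qT.

(* For a != b, each lift s of a has exactly one lift u of b in (s, s + 5);
   the arc is the image of (s, u), and does not depend on s. *)
Definition open_arc (a b : circle) : set circle :=
  if a == b then ~` [set a]
  else [set z | exists s t u : R,
         [/\ to_circle s = a, to_circle u = b, to_circle t = z,
             s < t < u & u < s + 5]].

Definition I5 : set (set circle) :=
  [set U | exists i j : int, U = open_arc (to_circle i%:~R) (to_circle j%:~R)].

Definition symmetric_set (X : set circle) : Prop := forall x, X x <-> X (- x).

Definition SI5 : set (set circle) :=
  [set X | symmetric_set X /\
           exists2 F : set (set circle), F `<=` I5 & X = \bigcup_(U in F) U].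

End Circle.

Arguments SI5 R : clear implicits.

(* Finite loopless undirected graphs, parallel edges allowed. *)
Record multigraph := Multigraph {
  vertex : finType;
  edge : finType;
  ends : edge -> {set vertex};
  card_ends : forall e, #|ends e| = 2%N }.

Definition adjacent (G : multigraph) : rel (vertex G) :=
  fun u v => [exists e : edge G, ends e == [set u; v]%SET].

Definition orientation (G : multigraph)
    (src tgt : edge G -> vertex G) : Prop :=
  forall e, ends e = [set src e; tgt e]%SET.

Definition mod5_flow (R : realType) (G : multigraph)
    (src tgt : edge G -> vertex G) (f : edge G -> circle R) : Prop :=
  forall v, \sum_(e | src e == v) f e = \sum_(e | tgt e == v) f e.

Record generalised_edge := GeneralisedEdge {
  graph_of :> multigraph;
  term1 : vertex graph_of;
  term2 : vertex graph_of;
  term_neq : term1 != term2 }.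

Section AddEdge.
Variable G : generalised_edge.

(* [None] is the added edge e^+, [Some e] an original edge. *)
Definition plus_ends (e : option (edge G)) : {set vertex G} :=
  if e is Some e' then ends e' else [set term1 G; term2 G]%SET.

Lemma card_plus_ends e : #|plus_ends e| = 2%N.
Proof. by case: e => [e|] /=; rewrite ?card_ends // cards2 term_neq. Qed.

Definition plus_graph : multigraph := Multigraph card_plus_ends.

End AddEdge.

Definition CP5 (R : realType) (G : generalised_edge) : set (circle R) :=
  [set z | exists (src tgt : edge (plus_graph G) -> vertex (plus_graph G))
                  (f : edge (plus_graph G) -> circle R),
     [/\ orientation src tgt, mod5_flow src tgt f,
         (forall e : edge G, open_arc (to_circle 1) (to_circle 4) (f (Some e))) &
         f None = z]].

Arguments CP5 R G : clear implicits.

Definition graphic (R : realType) (A : set (circle R)) : Prop :=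
  exists G : generalised_edge, CP5 R G = A.

Definition GI5 (R : realType) : set (set (circle R)) :=
  [set A | SI5 R A /\ graphic A].

Arguments GI5 R : clear implicits.

(* If the terminals lie in different components of G then e^+ is a bridge of
   G^+, every flow vanishes on it, and CP5 is empty or {0}; the latter is not
   open, hence not in SI5. *)
Definition terminals_joined (G : generalised_edge) : Prop :=
  connect (@adjacent G) (term1 G) (term2 G).

(* Main.v *)
Require Import Defs.
From mathcomp Require Import all_boot all_order all_algebra.
From mathcomp Require Import boolp classical_sets reals.
From mathcomp Require Import ring lra zify.

(** A modulo-5 flow with values in (1,4) on the edges of an oriented graph
    lifts to a real-valued function [h] with [1 < h e < 4] on these edges and
    with all divergences in 5Z.  For fixed divergences such lifts form an open
    polytope whose constraint matrix is a network matrix and whose bounds and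
    right-hand sides are integers, so the values taken by the added edge form
    an open interval with integral ends.  Concretely, a set belongs to SI5 iff
    it is symmetric and contains, with each of its points, the smallest integer
    arc around that point ([SI5P]).  Pushing flow around circuits of edges with
    non-integral values brings the value of the added edge to the next integer
    without leaving the closed bounds ([round_up]), and a mixture of the result
    with the original flow takes any value in between, strictly inside the
    bounds ([cell_flow]).  When the value of the added edge is itself an
    integer, a circuit through the added edge, which exists since the terminals
    are joined, moves it a little in both directions ([perturb]).  This gives
    [CP5_SI5].

    For the converse, a member of SI5 is determined by which of the points 0,
    1/2, 1, 3/2, 2, 5/2 it contains ([SI5_sample]).  Replacing the edges of a
    network by generalised edges amounts to restricting the flow on these edges
    to their capacities ([net_graphic_capacity]); in particular capacities are
    closed under intersection (series) and under addition of sets (parallel).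
    It is therefore enough to find, for each of the six points, one capacity
    that omits the point but contains every member of SI5 that omits it.  With
    X = (1,2) u (3,4), these are
    - for 0, the complement of 0, equal to (1,4) + (-1,1);
    - for 1/2, the arc (1,4) of a single edge;
    - for 1, the complement of 1 and -1, equal to X + X;
    - for 3/2, the set (-1,1) u (2,3), given by the complete graph on four
      vertices without the edge between the terminals, two edges being
      restricted to X;
    - for 2, the complement of 2 and -2, given by the same graph without
      restriction;
    - for 5/2, the arc (-2,2), equal to (-1,1) + (-1,1).
    Here X is the intersection of (1,4) and (-2,2).  The remaining arc (-1,1)
    is the capacity of the Petersen graph without one edge; the point is that
    the Petersen graph has no modulo-5 flow with values in (1,4)
    ([petersen_no_flow]).  In such a flow the three values leaving a vertex,
    lifted to (1,4), sum to 5 or to 10.  Each kind of vertex occurs five times,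
    and no vertex can be of the same kind as two of its neighbours; but every
    partition of the Petersen graph into two sets of five vertices has a vertex
    with two neighbours on its own side ([petersen_balanced]). *)

Set Implicit Arguments.
Unset Strict Implicit.
Unset Printing Implicit Defensive.

Import Order.TTheory GRing.Theory Num.Theory.
Local Open Scope classical_set_scope.
Local Open Scope ring_scope.

(** * Integer cells of the circle *)

Section CirclePoints.
Variable R : realType.
Local Notation circ := (@to_circle R).

Lemma to_circleD (x y : R) : circ (x + y) = circ x + circ y.
Proof. by rewrite /to_circle !piE. Qed.

Lemma to_circleN (x : R) : circ (- x) = - circ x.
Proof. by rewrite /to_circle !piE. Qed.

Lemma to_circle0 : circ 0 = 0.
Proof. by rewrite /to_circle !piE. Qed.

Lemma to_circle_eq (x y : R) :
  circ x = circ y <-> exists k : int, x = y + 5 * k%:~R.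
Proof.
split=> [/eqmodP|[k ->]].
  rewrite /= /Quotient.equiv inE => /intrP[k hk].
  by exists k; rewrite -hk; field.
apply/eqmodP; rewrite /= /Quotient.equiv inE addrAC subrr add0r mulrC.
by rewrite mulKf ?intr_int // pnatr_eq0.
Qed.

End CirclePoints.

Section Cells.
Variable R : realType.
Local Notation circ := (@to_circle R).

Lemma to_circle_surj (z : circle R) : exists t, circ t = z.
Proof. by exists (repr z); rewrite /to_circle reprK. Qed.

Lemma to_circle_centred (z : circle R) :
  exists t, [/\ circ t = z, - (5 / 2) <= t & t < 5 / 2].
Proof.
have [t <-] := to_circle_surj z.
exists (t - 5 * (Num.floor (t / 5 + 1 / 2))%:~R); split.
- by apply/to_circle_eq; exists (- Num.floor (t / 5 + 1 / 2)); rewrite mulrNz; ring.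
- have := floor_le (t / 5 + 1 / 2); lra.
- have := floorD1_gt (t / 5 + 1 / 2); rewrite intrD; lra.
Qed.

Lemma arcP (a b : int) (z : circle R) : (a < b < a + 5)%R ->
  open_arc (circ a%:~R) (circ b%:~R) z <->
  exists2 t, a%:~R < t < b%:~R & circ t = z.
Proof.
move=> /andP[ab ba].
have ab' : (a%:~R < b%:~R :> R) by rewrite ltr_int.
have ba' : (b%:~R < a%:~R + 5 :> R) by rewrite -[5]/(5%:~R) -intrD ltr_int.
have neq : (circ a%:~R == circ b%:~R) = false.
  apply/eqP => /to_circle_eq[k hk].
  have {hk} : (a = b + 5 * k)%R.
    by apply/eqP; rewrite -(eqr_int R) hk intrD intrM.
  lia.
rewrite /open_arc neq; split=> [[s [t [u]]]|[t tab <-]]; last first.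
  by exists a%:~R, t, b%:~R; split=> //; rewrite ab'.
case=> /to_circle_eq[k sk] /to_circle_eq[l ul] <- /andP[st tu] us.
have kl : k = l.
  move: ab' ba' st tu us; rewrite sk ul => ab' ba' st tu us.
  have h1 : (b + 5 * l < a + 5 * k + 5)%R.
    by rewrite -(ltr_int R) !intrD !intrM; lra.
  have h2 : (a + 5 * k < b + 5 * l)%R.
    by rewrite -(ltr_int R) !intrD !intrM; lra.
  lia.
exists (t - 5 * k%:~R); first by subst l; lra.
by apply/to_circle_eq; exists (- k); rewrite mulrNz; ring.
Qed.

(** [t'] lies in the smallest open integer interval that contains [t]. *)
Definition cellmate (t t' : R) : Prop := exists n : int,
  (n%:~R < t < n%:~R + 1 /\ n%:~R < t' < n%:~R + 1) \/
  (t = n%:~R /\ n%:~R - 1 < t' < n%:~R + 1).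

Lemma cellmate_between (a b : int) (t t' : R) : cellmate t t' ->
  a%:~R < t < b%:~R -> a%:~R < t' < b%:~R.
Proof.
have lt_intS (m n : int) : (m%:~R < n%:~R + 1 :> R) -> m%:~R <= n%:~R :> R.
  by rewrite -(intrD _ n 1) ltr_int ltzD1 ler_int.
case=> n [[/andP[nt tn] /andP[nt' tn']]|[-> nt']] /andP[ta tb].
  have := lt_intS a n (lt_trans ta tn).
  have : n%:~R + 1 <= b%:~R :> R.
    have : (n%:~R < b%:~R :> R) by apply: lt_trans tb.
    by rewrite -(intrD _ n 1) ltr_int ler_int -ltzD1 ltrD2r.
  lra.
have : n%:~R + 1 <= b%:~R :> R by move: tb; rewrite -(intrD _ n 1) ltr_int ler_int -ltzD1 ltrD2r.
have : a%:~R + 1 <= n%:~R :> R by move: ta; rewrite -(intrD _ a 1) ltr_int ler_int -ltzD1 ltrD2r.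
lra.
Qed.

Lemma cellmateDint (t t' : R) (k : int) :
  cellmate t t' -> cellmate (t + k%:~R) (t' + k%:~R).
Proof.
case=> n h; exists (n + k); rewrite intrD.
case: h => [[h1 h2]|[-> h2]]; [left; split; lra | right; split => //; lra].
Qed.

Lemma cellmate_int (t : R) (k : int) : cellmate t k%:~R -> t = k%:~R.
Proof.
case=> n [[_]|[->]]; rewrite -(intrD _ n 1) -?(intrB _ n 1) !ltr_int => /andP[h1 h2].
  lia.
by congr (_%:~R); lia.
Qed.

(** The ends of an arc lift to integers, and an integer interval cannot
    separate [t] from [t']; in the case of the arc [(x,x)], [t'] can only be
    the missing integer if [t] is. *)
Lemma I5_cellmate (U : set (circle R)) (t t' : R) :
  I5 U -> cellmate t t' -> U (circ t) -> U (circ t').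
Proof.
case=> i [j ->]; rewrite /open_arc; case: eqP => [_|_] tt'.
  move=> h /to_circle_eq[k hk]; apply: h => /=; apply/to_circle_eq; exists k.
  move: tt'; rewrite hk -[5]/(5%:~R) -intrM -intrD => /cellmate_int ->.
  by rewrite intrD.
case=> s [t0 [u [/to_circle_eq[k sk] /to_circle_eq[l ul] /to_circle_eq[m tm] stu us]]].
exists s, (t' + 5 * m%:~R), u; split=> //.
- by apply/to_circle_eq; exists k.
- by apply/to_circle_eq; exists l.
- by apply/to_circle_eq; exists m.
move: stu; rewrite sk tm ul.
have eI (x y : int) : (x%:~R + 5 * y%:~R = (x + 5 * y)%:~R :> R).
  by rewrite intrD intrM.
rewrite !eI; apply: cellmate_between.
by rewrite -[5]/(5%:~R) -intrM; apply: cellmateDint.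
Qed.

(** Around each point the integer arcs have a smallest element, so that a union
    of integer arcs is a set stable under [cellmate]. *)
Lemma SI5P (X : set (circle R)) : SI5 R X <->
  symmetric_set X /\
  forall t t', cellmate t t' -> X (circ t) -> X (circ t').
Proof.
split=> [[symX [F FI XF]]|[symX cX]]; split=> //.
  by rewrite XF => t t' tt' [U FU Ut]; exists U => //; apply: I5_cellmate Ut; [apply: FI|].
exists [set U | I5 U /\ U `<=` X]; first by move=> U [].
apply/seteqP; split=> [z Xz|z [U [_ UX] Uz]]; last exact: UX.
have [t tz] := to_circle_surj z.
suff [a [b [ab tab h]]] : exists a b : int, [/\ (a < b < a + 5)%R, a%:~R < t < b%:~R &
    forall t', a%:~R < t' < b%:~R -> cellmate t t'].
  exists (open_arc (circ a%:~R) (circ b%:~R)); last by apply/arcP => //; exists t.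
  split; first by exists a, b.
  move=> w /(arcP _ ab)[t' t'ab <-]; apply: cX (h _ t'ab) _.
  by rewrite tz.
have := floor_le t; have := floorD1_gt t; set n := Num.floor t => tn.
rewrite le_eqVlt => /orP[/eqP nt|nt].
  exists (n - 1), (n + 1); split; first lia.
    by rewrite intrB intrD -nt; lra.
  by move=> t'; rewrite intrB intrD => ?; exists n; right.
exists n, (n + 1); split; first lia.
  by rewrite nt.
by move=> t' ?; exists n; left; move: tn; rewrite intrD; split; lra.
Qed.

(** One point from each of the cells {0}, (0,1), {1}, (1,2), {2}, (2,3), whose
    opposites cover the rest of the circle. *)
Definition sample (k : 'I_6) : R := k%:R / 2.

Lemma SI5_sample (z : circle R) :
  exists k : 'I_6, forall X, SI5 R X -> X z <-> X (circ (sample k)).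
Proof.
have [t [<- t1 t2]] := to_circle_centred z.
suff [k hk] : exists k : 'I_6, cellmate `|t| (sample k) /\ cellmate (sample k) `|t|.
  exists k => X /SI5P[symX cX].
  have -> : X (circ t) <-> X (circ `|t|).
    have [_|_] := ger0P t; first by [].
    by rewrite to_circleN -symX.
  by split; apply: cX; case: hk.
have {t1 t2} : `|t| <= 5 / 2 by rewrite ler_norml; lra.
move: `|t| (normr_ge0 t) => {}t t0 t5.
have mk (k : nat) (k6 : (k < 6)%N) (n : int) :
  (k%:R / 2 = n%:~R :> R /\ t = n%:~R) \/
  (n%:~R < t < n%:~R + 1 /\ n%:~R < (k%:R / 2 : R) < n%:~R + 1) ->
  exists k : 'I_6, cellmate t (sample k) /\ cellmate (sample k) t.
  move=> h; exists (Ordinal k6); rewrite /sample /=; case: h => [[-> ->]|[h1 h2]].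
    by split; exists n; right; split => //; lra.
  by split; exists n; left.
have [t00|t00] := eqVneq t 0.
  by apply: (mk 0%N isT 0); left; rewrite t00; split=> //; lra.
have [t11|t11] := eqVneq t 1.
  by apply: (mk 2%N isT 1); left; rewrite t11; split=> //; lra.
have [t22|t22] := eqVneq t 2.
  by apply: (mk 4%N isT 2); left; rewrite t22; split=> //; lra.
move: t00 t11 t22; rewrite !neq_lt => /orP[|a0]; first lra.
move=> /orP[a1 _|a1 /orP[a2|a2]].
- by apply: (mk 1%N isT 0); right; split; lra.
- by apply: (mk 3%N isT 1); right; split; lra.
- by apply: (mk 5%N isT 2); right; split; lra.
Qed.

End Cells.

(** * Real flows between integral bounds *)

Section Divergence.
Variables (V E : finType) (src tgt : E -> V).

Definition divergence (M : zmodType) (f : E -> M) (v : V) : M :=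
  \sum_(e | src e == v) f e - \sum_(e | tgt e == v) f e.

Lemma divergenceD (M : zmodType) (f g : E -> M) v :
  divergence (fun e => f e + g e) v = divergence f v + divergence g v.
Proof. by rewrite /divergence !big_split /= opprD addrACA. Qed.

Lemma divergenceZ (K : pzRingType) (c : K) (f : E -> K) v :
  divergence (fun e => c * f e) v = c * divergence f v.
Proof. by rewrite /divergence -!mulr_sumr -mulrBr. Qed.

(** Summing the conservation law over a vertex set kills the internal edges. *)
Lemma divergence_set (M : zmodType) (f : E -> M) (S : {pred V}) :
  \sum_(v in S) divergence f v =
  \sum_(e | (src e \in S) && (tgt e \notin S)) f e -
  \sum_(e | (src e \notin S) && (tgt e \in S)) f e.
Proof.
have part (h : E -> V) : \sum_(v in S) \sum_(e | h e == v) f e =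
    \sum_(e | h e \in S) f e.
  rewrite (partition_big h (mem S)) //=; apply: eq_bigr => v vS.
  by apply: eq_bigl => e; case: eqP => [->|]; rewrite ?andbT ?andbF ?vS.
rewrite /divergence big_split sumrN /= !part.
rewrite (bigID (fun e => tgt e \in S)) [X in _ - X](bigID (fun e => src e \in S)) /=.
under [X in _ - (X + _)]eq_bigl => e do rewrite andbC.
rewrite opprD addrACA subrr add0r; congr (_ - _).
by apply: eq_bigl => e; rewrite andbC.
Qed.

Definition link (F : {pred E}) : rel V := fun u v =>
  [exists e in F, ((src e == u) && (tgt e == v)) || ((src e == v) && (tgt e == u))].

Lemma divergence_unit (K : pzRingType) (e : E) w :
  divergence (fun e' => (e' == e)%:R : K) w = (w == src e)%:R - (w == tgt e)%:R.
Proof.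
have one (h : E -> V) : \sum_(e' | h e' == w) (e' == e)%:R = (w == h e)%:R :> K.
  rewrite big_mkcond (bigD1 e) //= eqxx big1 ?addr0; first by rewrite eq_sym; case: eqP.
  by move=> i /negbTE ->; case: ifP.
by rewrite /divergence !one.
Qed.

(** The edges of a path get the value 1 when it runs along them and -1 when it
    runs against them; repeated edges add up. *)
Lemma connect_unit_flow (K : pzRingType) (F : {pred E}) (u v : V) :
  connect (link F) u v -> exists c : E -> K, (forall e, e \notin F -> c e = 0) /\
    forall w, divergence c w = (w == u)%:R - (w == v)%:R.
Proof.
case/connectP => p; elim: p u => [u _ ->|x p IH u /= /andP[ux xp] vE].
  by exists (fun _ => 0); split=> // w; rewrite /divergence !big1 // !subrr.
have [c [c0 cdiv]] := IH _ xp vE.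
case/existsP: ux => e /andP[eF ends_e].
have notF e' : e' \notin F -> (e' == e)%:R = 0 :> K by case: eqP => // ->; rewrite eF.
case/orP: ends_e => /andP[/eqP su /eqP tx].
  exists (fun e' => (e' == e)%:R + c e'); split=> [e' e'F|w].
    by rewrite notF // c0 // addr0.
  by rewrite divergenceD divergence_unit cdiv su tx addrA subrK.
exists (fun e' => -1 * (e' == e)%:R + c e'); split=> [e' e'F|w].
  by rewrite notF // c0 // mulr0 addr0.
by rewrite divergenceD divergenceZ divergence_unit cdiv su tx mulN1r opprB addrA subrK.
Qed.

(** If no path of [F] closed [e0] up to a circuit, then in the cut around the
    [F]-component of [tgt e0] every edge other than [e0] would have its value
    in the subgroup [S], hence so would [e0]. *)
Lemma cut_or_circuit (F : {pred E}) (e0 : E) (M : zmodType) (f : E -> M)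
    (S : zmodClosed M) :
  (forall v, divergence f v \in S) ->
  (forall e, e \notin F -> e != e0 -> f e \in S) ->
  f e0 \notin S -> connect (link F) (tgt e0) (src e0).
Proof.
move=> divS fS fe0; apply: contraNT fe0 => ncon.
pose C : {pred V} := [pred v | connect (link F) (tgt e0) v].
have linkC e : e \in F -> (src e \in C) = (tgt e \in C).
  move=> eF; rewrite !inE.
  have l1 : connect (link F) (src e) (tgt e).
    by apply: connect1; apply/existsP; exists e; rewrite eF !eqxx.
  have l2 : connect (link F) (tgt e) (src e).
    by apply: connect1; apply/existsP; exists e; rewrite eF !eqxx orbT.
  by apply/idP/idP => h; apply: connect_trans h _.
have crossS e : (src e \in C) (+) (tgt e \in C) -> e != e0 -> f e \in S.
  by move=> cr; apply: fS; apply/negP => /linkC h; rewrite h addbb in cr.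
have srcC : src e0 \notin C by rewrite inE.
have tgtC : tgt e0 \in C by rewrite inE connect0.
have : \sum_(v in C) divergence f v \in S by apply: rpred_sum.
rewrite divergence_set (bigD1 e0 (P := fun e => (src e \notin C) && (tgt e \in C))) /=;
  last by rewrite srcC tgtC.
set X := \sum_(_ | _) _; set Y := \sum_(_ | _) _ => hXY.
have XS : X \in S.
  apply: rpred_sum => e /andP[h1 h2]; apply: crossS; first by rewrite h1 (negbTE h2).
  by apply: contraNneq srcC => <-.
have YS : Y \in S.
  by apply: rpred_sum => e /andP[/andP[h1 h2]]; apply: crossS; rewrite h2 (negbTE h1).
by move: hXY; rewrite rpredBl // rpredDr.
Qed.

End Divergence.

Section Rounding.
Variables (R : realType) (V E : finType) (src tgt : E -> V).
Local Notation div := (divergence src tgt).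

(** Pushing flow around a circuit of edges with non-integral value, through
    [e0] and in the direction that increases [h e0], until some edge reaches one
    of its bounds; the number of non-integral edges drops. *)
Lemma round_up (lo hi : E -> int) (e0 : E) (h : E -> R) :
  (forall v, div h v \is a Num.int) ->
  (forall e, (lo e)%:~R <= h e <= (hi e)%:~R) ->
  exists g : E -> R, [/\ forall v, div g v = div h v,
    forall e, (lo e)%:~R <= g e <= (hi e)%:~R, g e0 \is a Num.int & h e0 <= g e0].
Proof.
have [n] := ubnP #|[pred e | h e \isn't a Num.int]|.
elim: n h => // n IH h /ltnSE hn hdiv hb.
have [e0int|e0frac] := boolP (h e0 \is a Num.int); first by exists h.
pose F : {pred E} := [pred e | (e != e0) && (h e \isn't a Num.int)].
have con : connect (link src tgt F) (tgt e0) (src e0).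
  apply: (cut_or_circuit hdiv _ e0frac) => e.
  by rewrite inE negb_and !negbK => /orP[->|].
have [c [c0 cdiv]] := connect_unit_flow R con.
(* The circuit: [e0] itself, closed up by the path [c]. *)
have [p [p0 pdiv pe0]] : exists p : E -> R,
    [/\ forall e, h e \is a Num.int -> p e = 0, forall v, div p v = 0 & p e0 > 0].
  exists (fun e => (e == e0)%:R + c e); split=> [e he|v|].
  - rewrite c0 ?inE ?he ?andbF // addr0.
    by case: eqP he e0frac => [-> ->|].
  - by rewrite divergenceD divergence_unit cdiv addrA subrK subrr.
  - by rewrite eqxx c0 ?addr0 // inE eqxx.
(* [room e] is the largest push that [e] tolerates. *)
pose room e := if p e > 0 then ((hi e)%:~R - h e) / p e else ((lo e)%:~R - h e) / p e.
have [m pm mmin] := @arg_minP _ _ _ e0 (fun e => p e != 0) room (lt0r_neq0 pe0).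
have strict e : p e != 0 -> (lo e)%:~R < h e < (hi e)%:~R.
  move=> pe; have eF : h e \isn't a Num.int by apply: contraNN pe => /p0 ->.
  have /andP[l u] := hb e; rewrite !lt_neqAle l u !andbT.
  by apply/andP; split; [apply: contraNneq eF => <- | apply: contraNneq eF => ->];
     apply: intr_int.
have room0 e : p e != 0 -> 0 < room e.
  move=> pe; have /andP[l u] := strict e pe; rewrite /room; case: ifP => pp.
    by rewrite divr_gt0 // subr_gt0.
  have pn : p e < 0 by rewrite lt_neqAle pe leNgt pp.
  by rewrite nmulr_lgt0 ?invr_lt0 // subr_lt0.
pose s := room m.
have hmint : h m + s * p m \is a Num.int.
  by rewrite /s /room; case: ifP => _; rewrite divfK // addrC subrK intr_int.
have bnd e : (lo e)%:~R <= h e + s * p e <= (hi e)%:~R.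
  have [pe|pe] := eqVneq (p e) 0; first by rewrite pe mulr0 addr0.
  have := mmin e pe; have := room0 m pm; rewrite -/s /room.
  have /andP[l u] := strict e pe; case: ifP => pp s0.
    rewrite ler_pdivlMr // => sp; have : 0 <= s * p e by rewrite mulr_ge0 // ltW.
    lra.
  have pn : p e < 0 by rewrite lt_neqAle pe leNgt pp.
  rewrite ler_ndivlMr // => sp; have : s * p e <= 0 by rewrite mulr_ge0_le0 // ltW.
  lra.
have [|||g [gdiv gb gint hg]] := IH (fun e => h e + s * p e).
- apply: leq_trans hn; apply: proper_card; apply/properP; split.
    apply/fintype.subsetP => e; rewrite !inE; apply: contraNN => he.
    by rewrite p0 ?mulr0 ?addr0.
  by exists m; rewrite !inE ?hmint // (contraNN _ pm) // => /p0 ->.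
- by move=> v; rewrite divergenceD divergenceZ pdiv mulr0 addr0.
- by [].
exists g; split=> //.
  by move=> v; rewrite gdiv divergenceD divergenceZ pdiv mulr0 addr0.
by apply: le_trans hg; rewrite lerDl mulr_ge0 ?ltW // room0.
Qed.

End Rounding.

Section CellFlow.
Variables (R : realType) (V E : finType) (src tgt : E -> V).
Local Notation div := (divergence src tgt).

Definition within (lo hi : E -> int) (h : E -> R) : Prop :=
  forall e, (lo e)%:~R < h e < (hi e)%:~R.

(** After rounding, [e0] sits at its upper bound; the segment from [h] to the
    rounded flow meets every value in between. *)
Lemma push_up (lo hi : E -> int) (e0 : E) (h : E -> R) (r : R) :
  (forall v, div h v \is a Num.int) -> within lo hi h ->
  hi e0 = lo e0 + 1 -> h e0 <= r < (hi e0)%:~R ->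
  exists g : E -> R,
    [/\ forall v, div g v = div h v, within lo hi g & g e0 = r].
Proof.
move=> hdiv hb hilo /andP[hr rhi].
have [e|g [gdiv gb gint hg]] := @round_up _ _ _ src tgt lo hi e0 h hdiv.
  by have /andP[l u] := hb e; rewrite !ltW.
have ge0 : g e0 = (hi e0)%:~R.
  have /andP[l _] := hb e0; have /andP[_ u] := gb e0.
  move: gint (lt_le_trans l hg) u => /intrP[k ->]; rewrite hilo ltr_int ler_int.
  by move=> h1 h2; congr (_%:~R); lia.
(* Mixing with a positive share of [h] restores the strict bounds. *)
have hh : 0 < (hi e0)%:~R - h e0 by lra.
pose a := ((hi e0)%:~R - r) / ((hi e0)%:~R - h e0).
have a0 : 0 < a by rewrite divr_gt0 // subr_gt0.
have a1 : a <= 1 by rewrite ler_pdivrMr // mul1r; lra.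
exists (fun e => a * h e + (1 - a) * g e); split=> [v|e|].
- by rewrite divergenceD !divergenceZ gdiv -mulrDl addrC subrK mul1r.
- have /andP[l u] := hb e; have /andP[l' u'] := gb e; nra.
- by rewrite ge0 /a; field; rewrite gt_eqF.
Qed.

(** The rounding of [-h] gives the downward moves. *)
Lemma cell_flow (lo hi : E -> int) (e0 : E) (h : E -> R) (r : R) :
  (forall v, div h v \is a Num.int) -> within lo hi h ->
  hi e0 = lo e0 + 1 -> (lo e0)%:~R < r < (hi e0)%:~R ->
  exists g : E -> R,
    [/\ forall v, div g v = div h v, within lo hi g & g e0 = r].
Proof.
move=> hdiv hb hilo /andP[lr rh].
have [hr|rh'] := leP (h e0) r; first by apply: push_up => //; rewrite hr.
have divN g v : div (fun e => - g e) v = - div g v :> R.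
  by rewrite /divergence !sumrN -opprB opprK addrC.
have [||||g [gdiv gb ge]] :=
  @push_up (fun e => - hi e) (fun e => - lo e) e0 (fun e => - h e) (- r).
- by move=> v; rewrite divN rpredN.
- by move=> e; have := hb e; rewrite !mulrNz !ltrN2 andbC.
- by rewrite hilo opprD subrK.
- by rewrite mulrNz lerN2 ltrN2 lr ltW.
exists (fun e => - g e); split=> [v|e|].
- by rewrite divN gdiv divN opprK.
- by have := gb e; rewrite !mulrNz ltrNl ltrNr andbC.
- by rewrite ge opprK.
Qed.

(** A push by a small amount along a circuit through [e0]; the value on [e0]
    itself is unconstrained. *)
Lemma perturb (e0 : E) (h : E -> R) (lo hi : E -> int) :
  connect (link src tgt (predC1 e0)) (tgt e0) (src e0) ->
  (forall e, e != e0 -> (lo e)%:~R < h e < (hi e)%:~R) ->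
  exists2 eps : R, 0 < eps < 1 & forall d, `|d| <= eps ->
    exists g : E -> R, [/\ forall v, div g v = div h v,
      forall e, e != e0 -> (lo e)%:~R < g e < (hi e)%:~R & g e0 = h e0 + d].
Proof.
move=> con hb.
have [c [c0 cdiv]] := connect_unit_flow R con.
pose slack e := Num.min (h e - (lo e)%:~R) ((hi e)%:~R - h e) / (`|c e| + 1).
have c1 e : 0 < `|c e| + 1 by rewrite ltr_wpDl.
have slack0 e : e != e0 -> 0 < slack e.
  move=> ne; rewrite divr_gt0 // lt_min !subr_gt0; exact: hb.
pose eps := \big[Num.min/(1 / 2 : R)]_(e | e != e0) slack e.
have eps0 : 0 < eps by apply: lt_bigmin => //; lra.
exists eps.
  rewrite eps0 /=; have : eps <= 1 / 2 by apply: bigmin_le_id.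
  lra.
move=> d de; exists (fun e => h e + d * ((e == e0)%:R + c e)); split=> [v|e ne|].
- by rewrite divergenceD divergenceZ divergenceD divergence_unit cdiv addrA subrK
    subrr mulr0 addr0.
- rewrite (negbTE ne) add0r.
  have : eps <= slack e by apply: bigmin_le_cond.
  rewrite ler_pdivlMr // le_min => /andP[s1 s2].
  have : `|d * c e| < eps * (`|c e| + 1).
    by have := ler_wpM2r (normr_ge0 (c e)) de; rewrite normrM; lra.
  rewrite ltr_norml; lra.
- by rewrite eqxx c0 ?inE ?eqxx // addr0 mulr1.
Qed.

End CellFlow.

(** * Capacities are unions of integer arcs *)

Section Capacity.
Variable R : realType.
Local Notation circ := (@to_circle R).
Local Notation mid := (open_arc (circ 1) (circ 4)).

Lemma midP (z : circle R) : mid z <-> exists2 t, 1 < t < 4 & circ t = z.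
Proof. exact: (@arcP R 1 4). Qed.

Lemma midN (z : circle R) : mid z -> mid (- z).
Proof.
case/midP => t t14 <-; apply/midP; exists (5 - t); first lra.
by rewrite -to_circleN; apply/to_circle_eq; exists 1; ring.
Qed.

Lemma divergenceE (V E : finType) (src tgt : E -> V) (M : zmodType) (f : E -> M) v :
  divergence src tgt f v = \sum_e (f e *+ (src e == v) - f e *+ (tgt e == v)).
Proof.
have bigE (P : pred E) : \sum_(e | P e) f e = \sum_e f e *+ P e.
  by rewrite big_mkcond; apply: eq_bigr => e _; case: (P e).
by rewrite /divergence !bigE -sumrB.
Qed.

Lemma big_option (T : finType) (M : nmodType) (F : option T -> M) :
  \sum_e F e = F None + \sum_e F (Some e).
Proof.
rewrite (bigD1 None) //= (reindex_omap (Some : T -> option T) id) /=; last by case.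
by congr (_ + _); apply: eq_bigl => e; rewrite eqxx.
Qed.

Lemma divergence_to_circle (V E : finType) (src tgt : E -> V) (h : E -> R) v :
  divergence src tgt (fun e => circ (h e)) v = circ (divergence src tgt h v).
Proof.
rewrite to_circleD to_circleN; congr (_ - _);
  by rewrite (big_morph _ (@to_circleD R) (to_circle0 R)).
Qed.

Lemma set2_inj (T : finType) (a b c d : T) : [set a; b]%SET = [set c; d]%SET ->
  (a = c /\ b = d) \/ (a = d /\ b = c).
Proof.
move=> eqS.
have /set2P[] : a \in [set c; d]%SET by rewrite -eqS set21.
  move=> ac; left; split=> //.
  have /set2P[ba|//] : b \in [set c; d]%SET by rewrite -eqS set22.
  by have /set2P[] : d \in [set a; b]%SET by [rewrite eqS set22]; congruence.
move=> ad; right; split=> //.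
have /set2P[//|bd] : b \in [set c; d]%SET by rewrite -eqS set22.
by have /set2P[] : c \in [set a; b]%SET by [rewrite eqS set21]; congruence.
Qed.

Lemma divergence_reorient (G : multigraph) (src tgt src' tgt' : edge G -> vertex G)
    (M : zmodType) (f : edge G -> M) v :
  orientation src tgt -> orientation src' tgt' ->
  divergence src' tgt' (fun e => if src e == src' e then f e else - f e) v =
  divergence src tgt f v.
Proof.
move=> o o'; rewrite !divergenceE; apply: eq_bigr => e _.
have : [set src e; tgt e]%SET = [set src' e; tgt' e]%SET by rewrite -o -o'.
case/set2_inj => -[-> ->]; first by rewrite eqxx.
case: eqP => [->|_] //.
by rewrite !mulNrn opprK addrC.
Qed.

Lemma orientation_exists (G : multigraph) :
  exists src tgt : edge G -> vertex G, orientation src tgt.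
Proof.
have /choice[o oP] : forall e : edge G, exists p, ends e = [set p.1; p.2]%SET.
  move=> e; have /eqP/cards2P[x [y [_ exy]]] := card_ends e.
  by exists (x, y).
by exists (fun e => (o e).1), (fun e => (o e).2).
Qed.

Section Oriented.
Variables (G : generalised_edge) (src tgt : edge G -> vertex G).
Hypothesis oriented : orientation src tgt.

(** The added edge is oriented from [term2] to [term1], so that a flow of value
    [z] on it crosses [G] from [term1] to [term2]. *)
Definition src_plus (e : option (edge G)) := if e is Some e' then src e' else term2 G.
Definition tgt_plus (e : option (edge G)) := if e is Some e' then tgt e' else term1 G.

Lemma orientation_plus :
  @orientation (plus_graph G) src_plus tgt_plus.
Proof. by case=> [e|] /=; [exact: oriented|rewrite finset.setUC]. Qed.

(** Both the orientation and the sign of the flow on the added edge may be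
    chosen, since (1,4) is symmetric: reversing an edge negates its value. *)
Lemma CP5_flow (z : circle R) : CP5 R G z <->
  exists f : option (edge G) -> circle R, [/\ f None = z,
    forall e, mid (f (Some e)) & forall v, divergence src_plus tgt_plus f v = 0].
Proof.
split=> [[s [t [f [o flow fmid fz]]]]|[f [fz fmid fdiv]]]; last first.
  exists src_plus, tgt_plus, f; split=> //; first exact: orientation_plus.
  by move=> v; apply/eqP; rewrite -subr_eq0; apply/eqP; apply: fdiv.
have fdiv v : divergence s t f v = 0.
  by rewrite /divergence flow subrr.
pose g e := if s e == src_plus e then f e else - f e.
have gdiv v : divergence src_plus tgt_plus g v = 0.
  by rewrite -(fdiv v); apply: (divergence_reorient _ _ o orientation_plus).
have gmid e : mid (g (Some e)).
  by rewrite /g; case: ifP => _; [|apply: midN]; apply: fmid.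
have [sN|sN] := boolP (s None == src_plus None).
  by exists g; split=> //; rewrite /g sN.
exists (fun e => - g e); split=> [|e|v].
- by rewrite /g (negbTE sN) opprK.
- exact: midN.
- have -> : divergence src_plus tgt_plus (fun e => - g e) v =
    - divergence src_plus tgt_plus g v by rewrite /divergence !sumrN -opprB opprK addrC.
  by rewrite gdiv oppr0.
Qed.

Lemma CP5_lift (r : R) : CP5 R G (circ r) <->
  exists h : option (edge G) -> R, [/\ h None = r,
    forall e, 1 < h (Some e) < 4 &
    forall v, circ (divergence src_plus tgt_plus h v) = 0].
Proof.
split=> [/CP5_flow[f [fz fmid fdiv]]|[h [hr hmid hdiv]]]; last first.
  apply/CP5_flow; exists (fun e => circ (h e)); split=> [|e|v].
  - by rewrite hr.
  - by apply/midP; exists (h (Some e)).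
  - by rewrite divergence_to_circle.
have /choice[h hP] : forall e, exists t, circ t = f e /\
    if e is None then t = r else 1 < t < 4.
  case=> [e|]; last by exists r.
  by have /midP[t t14 tf] := fmid e; exists t.
exists h; split=> [|e|v].
- by have [] := hP None.
- by have [] := hP (Some e).
- rewrite -divergence_to_circle -(fdiv v).
  by congr (divergence _ _ _ _); apply/funext => e; case: (hP e).
Qed.

Lemma link_plus : connect (@adjacent G) (term1 G) (term2 G) =
  connect (link src_plus tgt_plus (predC1 None)) (tgt_plus None) (src_plus None).
Proof.
apply: eq_connect => u v; apply/existsP/existsP => [[e /eqP euv]|[[e|] /andP[]]] //.
  exists (Some e); rewrite /=; move: euv; rewrite oriented => /set2_inj.
  by case=> -[-> ->]; rewrite !eqxx ?orbT.
by move=> _ /= /orP[]/andP[/eqP <- /eqP <-]; exists e; rewrite oriented // finset.setUC.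
Qed.

(** Otherwise the added edge is a bridge and carries no flow. *)
Lemma terminals_joined_of_flow (z : circle R) :
  CP5 R G z -> z != 0 -> terminals_joined G.
Proof.
have [r <-] := to_circle_surj z.
case/CP5_lift => h [hr hmid hdiv] r0; rewrite /terminals_joined link_plus.
have fiveP (x : R) : (x \in @fiveZ R) = (circ x == 0).
  rewrite -to_circle0; apply/idP/eqP => [xZ|/eqmodP].
    by apply/eqmodP; rewrite /= /Quotient.equiv subr0.
  by rewrite /= /Quotient.equiv subr0.
apply: (cut_or_circuit (f := h) (S := @fiveZ R)).
- by move=> v; rewrite fiveP hdiv.
- by move=> e; rewrite !inE => /negbTE ->.
- by rewrite hr fiveP.
Qed.

(** In the lift the edges of [G] are bounded by 1 and 4, and the added edge by
    the ends of the unit cell of its value. *)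
Lemma CP5_cellmate (r r' : R) : terminals_joined G ->
  cellmate r r' -> CP5 R G (circ r) -> CP5 R G (circ r').
Proof.
rewrite /terminals_joined link_plus => con rr' /CP5_lift[h [hr hmid hdiv]].
pose lo (n : int) (e : option (edge G)) := if e is Some _ then 1 else n.
pose hi (n : int) (e : option (edge G)) := if e is Some _ then 4 else n + 1.
have div_int (g : option (edge G) -> R) :
    (forall v, circ (divergence src_plus tgt_plus g v) = 0) ->
    forall v, divergence src_plus tgt_plus g v \is a Num.int.
  move=> gdiv v; have := gdiv v; rewrite -to_circle0 => /to_circle_eq[k ->].
  by rewrite add0r -[5]/(5%:~R) -intrM intr_int.
have move_in_cell (n : int) (g : option (edge G) -> R) :
    (forall e, 1 < g (Some e) < 4) ->
    (forall v, circ (divergence src_plus tgt_plus g v) = 0) ->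
    n%:~R < g None < n%:~R + 1 -> n%:~R < r' < n%:~R + 1 -> CP5 R G (circ r').
  move=> gmid gdiv gn rn.
  have [||||g' [g'div g'b g'r]] := @cell_flow R _ _ src_plus tgt_plus (lo n) (hi n) None g r'.
  - exact: div_int.
  - by case=> [e|]; [exact: gmid|rewrite /= intrD].
  - by [].
  - by rewrite /= intrD.
  apply/CP5_lift; exists g'; split=> // [e|v]; first exact: (g'b (Some e)).
  by rewrite g'div.
case: rr' => n [[rn rn']|[rn rn']]; first by apply: (move_in_cell n h) => //; rewrite hr.
have h_edges e : e != None -> (lo 0 e)%:~R < h e < (hi 0 e)%:~R by case: e.
have [eps eps01 move_eps] := perturb (lo := lo 0) (hi := hi 0) con h_edges.
have [rr|rr|rr] := ltgtP r' n%:~R.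
- have [|g [gdiv gb gN]] := move_eps (- eps); first by rewrite normrN gtr0_norm; lra.
  apply: (move_in_cell (n - 1) g).
  + by move=> e; apply: (gb (Some e)).
  + by move=> v; rewrite gdiv.
  + by rewrite gN hr rn intrB; lra.
  + by rewrite intrB; lra.
- have [|g [gdiv gb gN]] := move_eps eps; first by rewrite gtr0_norm; lra.
  apply: (move_in_cell n g).
  + by move=> e; apply: (gb (Some e)).
  + by move=> v; rewrite gdiv.
  + by rewrite gN hr rn; lra.
  + by lra.
- by apply/CP5_lift; exists h; split=> //; rewrite hr rn.
Qed.

End Oriented.

Lemma CP5_opp (G : generalised_edge) (z : circle R) : CP5 R G z -> CP5 R G (- z).
Proof.
have [src [tgt o]] := orientation_exists G.
case/(CP5_flow o) => f [fz fmid fdiv]; apply/(CP5_flow o).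
exists (fun e => - f e); split=> [|e|v].
- by rewrite fz.
- exact: midN.
- have := fdiv v; rewrite /divergence !sumrN -opprD => ->; exact: oppr0.
Qed.

Theorem CP5_SI5 (G : generalised_edge) : terminals_joined G -> SI5 R (CP5 R G).
Proof.
move=> joined; apply/SI5P; split=> [z|t t' tt'].
  by split=> /CP5_opp; rewrite ?opprK.
have [src [tgt o]] := orientation_exists G.
exact: (CP5_cellmate o).
Qed.

End Capacity.

(** * Networks of generalised edges *)

Section Networks.
Variable R : realType.
Local Notation circ := (@to_circle R).
Local Notation C := (circle R).
Local Notation mid := (open_arc (circ 1) (circ 4)).

(** The divergence of a flow of value [a] along an edge from [u] to [w]. *)
Definition carry (u w : nat) (a : C) (v : nat) : C := a *+ (v == u) - a *+ (v == w).

Definition network := seq (nat * nat * set C).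

(** [d] is the divergence of a flow on [N] whose value on each edge lies in the
    set attached to this edge; the flow is peeled off edge by edge. *)
Fixpoint net (N : network) (d : nat -> C) : Prop :=
  if N is (u, w, A) :: N' then exists2 a, A a & net N' (fun v => d v - carry u w a v)
  else forall v, d v = 0.

(** The terminals are the vertices 0 and 1. *)
Definition capacity (N : network) : set C := [set z | net N (carry 0 1 z)].

Definition plain (L : seq (nat * nat)) : network := [seq (e, mid) | e <- L].

Definition loopless (L : seq (nat * nat)) := all (fun e => e.1 != e.2) L.

Definition net_graphic (A : set C) : Prop :=
  exists2 L, loopless L & A = capacity (plain L).

Definition bounded (n : nat) (N : network) :=
  all (fun x => (x.1.1 < n)%N && (x.1.2 < n)%N) N.

Lemma net_ext (N : network) d d' : d =1 d' -> net N d -> net N d'.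
Proof. by move=> /funext ->. Qed.

Lemma net_cat (N1 N2 : network) d : net (N1 ++ N2) d <->
  exists2 d1, net N1 d1 & net N2 (fun v => d v - d1 v).
Proof.
elim: N1 d => [|[[u w] A] N1 IH] d /=.
  split=> [nd|[d1 d10]]; first by exists (fun=> 0) => //; under eq_fun do rewrite subr0.
  by under eq_fun do rewrite d10 subr0.
split=> [[a Aa /IH[d1 n1 n2]]|[d1 [a Aa n1] n2]].
  exists (fun v => d1 v + carry u w a v).
    by exists a => //; under eq_fun do rewrite addrK.
  by under eq_fun do rewrite opprD addrCA addrC.
exists a => //; apply/IH; exists (fun v => d1 v - carry u w a v) => //.
by apply: net_ext n2 => v; rewrite -[RHS]addrA -opprD [_ + (d1 v - _)]addrC subrK.
Qed.

Lemma carryD (u w : nat) (a b : C) v : carry u w (a + b) v = carry u w a v + carry u w b v.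
Proof. by rewrite /carry !mulrnDl opprD addrACA. Qed.

Lemma net_support n (N : network) d v : bounded n N -> net N d -> (n <= v)%N -> d v = 0.
Proof.
elim: N d => [|[[u w] A] N IH] d /=; first by move=> _ ->.
case/andP => /andP[un wn] bN [a _ nd] nv; rewrite -(IH _ bN nd nv) /carry.
by rewrite !gtn_eqF ?subr0 ?subr0 //; lia.
Qed.

Lemma net_total n (N : network) d : bounded n N -> net N d -> \sum_(v < n) d v = 0.
Proof.
elim: N d => [|[[u w] A] N IH] d /=; first by move=> _ d0; rewrite big1.
case/andP => /andP[un wn] bN [a _ /(IH _ bN)]; rewrite sumrB => /eqP.
rewrite subr_eq0 => /eqP ->.
have one (k : nat) : (k < n)%N -> \sum_(v < n) a *+ (v == k :> nat) = a.
  move=> kn; rewrite (bigD1 (Ordinal kn)) //= eqxx big1 ?addr0 // => i.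
  by rewrite -val_eqE /= => /negbTE ->.
by rewrite sumrB !one // subrr.
Qed.

Lemma carry_relabel (rho : nat -> nat) u w a k : injective rho ->
  carry (rho u) (rho w) a (rho k) = carry u w a k.
Proof. by move=> inj; rewrite /carry !(inj_eq inj). Qed.

Lemma carry_out u w a v : v != u -> v != w -> carry u w a v = 0.
Proof. by rewrite /carry => /negbTE -> /negbTE ->; rewrite subrr. Qed.

Lemma net_relabel (rho : nat -> nat) (N : network) d : injective rho ->
  net [seq (rho x.1.1, rho x.1.2, x.2) | x <- N] d <->
  exists2 d0, net N d0 &
    (forall k, d (rho k) = d0 k) /\ (forall v, (forall k, v != rho k) -> d v = 0).
Proof.
move=> inj; elim: N d => [|[[u w] A] N IH] d /=.
  split=> [d0|[d0 z0 [dr dn]] v]; first by exists (fun=> 0).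
  have [[k ->]|nk] := pselect (exists k, v = rho k); first by rewrite dr.
  by apply: dn => k; apply/eqP => vk; apply: nk; exists k.
split=> [[a Aa /IH[d0 n0 [dr dn]]]|[d0 [a Aa n0] [dr dn]]].
  exists (fun k => d0 k + carry u w a k).
    by exists a => //; under eq_fun do rewrite addrK.
  split=> [k|v vk]; first by rewrite -dr (carry_relabel _ _ _ _ inj) subrK.
  by have := dn v vk; rewrite carry_out // subr0.
exists a => //; apply/IH; exists (fun k => d0 k - carry u w a k) => //.
by split=> [k|v vk]; rewrite ?dr ?(carry_relabel _ _ _ _ inj) // dn // carry_out // subrr.
Qed.

Lemma bounded_exists (N : network) n : exists2 m, (n <= m)%N & bounded m N.
Proof.
elim: N => [|[[u w] A] N [m nm bN]]; first by exists n.
exists (maxn m (maxn u.+1 w.+1)); first by rewrite leq_max nm.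
rewrite /bounded /= !leq_max !ltnSn !orbT /=; apply: sub_all bN => x.
by rewrite !leq_max => /andP[-> ->].
Qed.

(** Induction on the edges of [N]: the generalised edge that replaces an edge
    from [u] to [w] is glued along [u] and [w], and its inner vertices are
    numbered from a bound [m] of the vertices used so far.  A divergence that
    vanishes on the inner vertices can only be that of a flow from [u] to [w],
    because its total is zero. *)
Lemma net_subst n (N : network) :
  (forall x, List.In x N -> [/\ x.1.1 != x.1.2, (x.1.1 < n)%N, (x.1.2 < n)%N &
    net_graphic x.2]) ->
  exists2 L, loopless L & forall d, (forall v, (n <= v)%N -> d v = 0) ->
    net N d <-> net (plain L) d.
Proof.
elim: N => [|[[u w] A] N IH] hN; first by exists [::].
have [|L' ll' L'P] := IH; first by move=> x xN; apply: hN; right.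
have [/= uw un wn [LA llA ->]] := hN (u, w, A) (or_introl erefl).
have [m nm bL'] := bounded_exists (plain L') n.
pose rho k := if k is k'.+1 then if k' is k''.+1 then (m + k'')%N else w else u.
have inj : injective rho.
  by move=> [|[|i]] [|[|j]] /=; move: uw; lia.
exists ([seq (rho e.1, rho e.2) | e <- LA] ++ L').
  rewrite /loopless all_cat; apply/andP; split; last exact: ll'.
  rewrite all_map; apply: sub_all llA => e /=.
  by rewrite (inj_eq inj).
have sup a d : (forall v, (n <= v)%N -> d v = 0) ->
    forall v, (n <= v)%N -> d v - carry u w a v = 0.
  by move=> ds v nv; rewrite ds // /carry !gtn_eqF ?subr0 //; lia.
move=> d ds; rewrite /plain map_cat.
have -> : [seq (e, mid) | e <- [seq (rho e.1, rho e.2) | e <- LA]] =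
    [seq (rho x.1.1, rho x.1.2, x.2) | x <- plain LA].
  by rewrite -!map_comp.
split=> [[a LAa nd]|/net_cat[d1 /(net_relabel _ _ inj)[d0 n0 [dr dn]] n2]].
  apply/net_cat; exists (carry u w a); last by apply/L'P => //; exact: sup.
  apply/net_relabel => //; exists (carry 0 1 a) => //; split=> [k|v vk].
    exact: (carry_relabel 0 1 a k inj).
  by rewrite carry_out ?(vk 0%N) ?(vk 1%N).
have d0s k : d0 k.+2 = 0.
  have mk : (m <= m + k)%N by rewrite leq_addr.
  have := net_support bL' n2 mk; rewrite (ds _ (leq_trans nm mk)) sub0r => /eqP.
  by rewrite oppr_eq0 -[(m + k)%N]/(rho k.+2) dr => /eqP.
have d01 : d0 1%N = - d0 0%N.
  have [p p2 bLA] := bounded_exists (plain LA) 2.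
  have := net_total bLA n0; case: p p2 {bLA} => [|[|p]] // _.
  rewrite !big_ord_recl big1 /= ?addr0; last by move=> i _; apply: d0s.
  by move/eqP; rewrite addrC addr_eq0 => /eqP.
have d0E : d0 = carry 0 1 (d0 0%N).
  apply/funext => -[|[|k]]; first by rewrite /carry eqxx subr0.
    by rewrite /carry eqxx sub0r.
  by rewrite d0s carry_out.
have d1E : d1 = carry u w (d0 0%N).
  apply/funext => v; have [[k ->]|nk] := pselect (exists k, v = rho k).
    by rewrite dr {1}d0E -(carry_relabel 0 1 _ k inj).
  have vk k : v != rho k by apply/eqP => vk; apply: nk; exists k.
  by rewrite dn // carry_out ?(vk 0%N) ?(vk 1%N).
exists (d0 0%N); first by rewrite /capacity /= -d0E.
by apply/L'P; [exact: sup|rewrite -d1E].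
Qed.

Lemma net_graphic_capacity n (N : network) : (1 < n)%N ->
  (forall x, List.In x N -> [/\ x.1.1 != x.1.2, (x.1.1 < n)%N, (x.1.2 < n)%N &
    net_graphic x.2]) -> net_graphic (capacity N).
Proof.
move=> n1 /net_subst[L ll LP]; exists L => //.
apply/seteqP; split=> z /= /LP; apply => v nv;
  by rewrite /carry !gtn_eqF ?subr0 //; lia.
Qed.

Lemma net_sum (N : network) d : net N d <-> exists a : nat -> C,
  (forall i, (i < size N)%N -> (nth (0, 1, set0)%N N i).2 (a i)) /\
  forall v, d v = \sum_(i < size N)
    carry (nth (0, 1, set0)%N N i).1.1 (nth (0, 1, set0)%N N i).1.2 (a i) v.
Proof.
elim: N d => [|[[u w] A] N IH] d /=.
  split=> [d0|[a [_ d0]] v]; last by rewrite d0 big_ord0.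
  by exists (fun=> 0); split=> // v; rewrite d0 big_ord0.
split=> [[a Aa /IH[b [bP bE]]]|[a [aP aE]]].
  exists (fun i => if i is j.+1 then b j else a); split=> [[|i]|v] //; first exact: bP.
  by rewrite big_ord_recl /= -bE addrC subrK.
exists (a 0%N); first exact: (aP 0%N).
apply/IH; exists (fun i => a i.+1); split=> [i|v]; first exact: (aP i.+1).
by rewrite aE big_ord_recl /= addrC addKr.
Qed.

(** The vertices are cut off at a bound [m.+2] that leaves room for the two
    terminals. *)
Lemma graphic_of_net (A : set C) : net_graphic A -> graphic A.
Proof.
case=> L ll ->.
have [m m2 bL] := bounded_exists (plain L) 2.
case: m m2 bL => [|[|m]] // _ bL.
pose edge_at (i : 'I_(size L)) := nth (0, 1)%N L i.
have edgeP i : [/\ (edge_at i).1 != (edge_at i).2, ((edge_at i).1 < m.+2)%N &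
    ((edge_at i).2 < m.+2)%N].
  have iL : edge_at i \in L by apply: mem_nth.
  split; first exact: (allP ll).
    by move: bL; rewrite /bounded all_map => /allP/(_ _ iL)/andP[].
  by move: bL; rewrite /bounded all_map => /allP/(_ _ iL)/andP[].
pose src i : 'I_m.+2 := inord (edge_at i).1.
pose tgt i : 'I_m.+2 := inord (edge_at i).2.
have srcE i : src i = (edge_at i).1 :> nat by rewrite inordK //; case: (edgeP i).
have tgtE i : tgt i = (edge_at i).2 :> nat by rewrite inordK //; case: (edgeP i).
have ends2 i : #|[set src i; tgt i]%SET| = 2%N.
  have neq : src i != tgt i.
    by apply/negP => /eqP/(congr1 val); rewrite /= srcE tgtE; case: (edgeP i) => /eqP.
  by rewrite cards2 neq.
have neq01 : (inord 0 : 'I_m.+2) != inord 1.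
  by apply/negP => /eqP/(congr1 val); rewrite /= !inordK.
pose G := @GeneralisedEdge (Multigraph ends2) _ _ neq01.
exists G; apply/seteqP.
have o : @orientation G src tgt by [].
have t1 : term1 G = 0%N :> nat by rewrite /= inordK.
have t2 : term2 G = 1%N :> nat by rewrite /= inordK.
have divE (f : option (edge G) -> C) (v : 'I_m.+2) :
  divergence (@src_plus G src) (@tgt_plus G tgt) f v =
  \sum_(i < size L) carry (edge_at i).1 (edge_at i).2 (f (Some i)) v -
  carry 0 1 (f None) v.
  rewrite divergenceE big_option addrC; congr (_ + _).
    by apply: eq_bigr => i _; rewrite /carry -srcE -tgtE !(eq_sym (v : nat)).
  rewrite opprB; congr (_ *+ _ - _ *+ _).
    by rewrite -t2 eq_sym.
  by rewrite -t1 eq_sym.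
split=> z; last first.
  case/net_sum => a [aP aE]; apply/(CP5_flow o).
  exists (fun e : option 'I_(size L) => if e is Some i then a i else z); split=> [//|i|v].
    have := aP (i : 'I_(size L)); rewrite size_map (nth_map (0, 1)%N) //; exact.
  rewrite divE aE; apply/eqP; rewrite subr_eq0; apply/eqP.
  rewrite size_map; apply: eq_bigr => i _.
  by rewrite (nth_map (0, 1)%N).
case/(CP5_flow o) => f [fz fmid fdiv]; apply/net_sum.
exists (fun k => if insub k is Some i then f (Some i) else 0); split=> [k|v].
  by rewrite size_map => kL; rewrite (nth_map (0, 1)%N) // insubT; exact: fmid.
have sumE : \sum_(i < size (plain L)) carry (nth (0, 1, set0)%N (plain L) i).1.1
      (nth (0, 1, set0)%N (plain L) i).1.2
      (if insub (i : nat) is Some j then f (Some j) else 0) v =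
    \sum_(i < size L) carry (edge_at i).1 (edge_at i).2 (f (Some i)) v.
  rewrite size_map; apply: eq_bigr => i _.
  by rewrite (nth_map (0, 1)%N) // valK.
rewrite sumE; have [vm|mv] := ltnP v m.+2.
  have := fdiv (Ordinal vm); rewrite divE fz => /eqP.
  by rewrite subr_eq0 => /eqP ->.
rewrite {1}/carry !gtn_eqF //; first last; try lia.
rewrite subr0 big1 // => i _; have [_ h1 h2] := edgeP i.
by rewrite /carry !gtn_eqF ?subr0 //; lia.
Qed.

Lemma net_graphic_SI5 (A : set C) : net_graphic A -> (exists2 z, A z & z != 0) -> SI5 R A.
Proof.
move=> /graphic_of_net[G <-] [z Az z0]; apply: CP5_SI5.
have [src [tgt o]] := orientation_exists G.
exact: terminals_joined_of_flow o z Az z0.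
Qed.

End Networks.

(** * The Petersen graph *)

(** The edge between the terminals 0 and 1 comes last, so that the first
    fourteen edges form the graph without it. *)
Definition petersen : seq (nat * nat) :=
  [:: (1, 2); (2, 3); (3, 4); (4, 0); (0, 5); (1, 6); (2, 7); (3, 8); (4, 9);
      (5, 7); (6, 8); (7, 9); (8, 5); (9, 6); (1, 0)]%N.

Definition petersen_nbr (v : nat) : seq nat :=
  [seq x <- iota 0 10 | ((v, x) \in petersen) || ((x, v) \in petersen)].

(** By inspection of the colourings of the ten vertices. *)
Lemma petersen_balanced (s : nat -> bool) : (\sum_(v < 10) s v = 5)%N ->
  exists w x y, [/\ (w < 10)%N, x \in petersen_nbr w, y \in petersen_nbr w, x != y &
    s x = s w /\ s y = s w].
Proof.
have check (b0 b1 b2 b3 b4 b5 b6 b7 b8 b9 : bool) :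
  let b := [:: b0; b1; b2; b3; b4; b5; b6; b7; b8; b9] in
  count id b = 5%N -> has (fun w => has (fun x => has (fun y =>
    [&& x != y, nth false b x == nth false b w & nth false b y == nth false b w])
    (petersen_nbr w)) (petersen_nbr w)) (iota 0 10).
  by case: b0; case: b1; case: b2; case: b3; case: b4; case: b5; case: b6;
     case: b7; case: b8; case: b9; vm_compute.
move=> s5.
have /hasP[w w10 /hasP[x xw /hasP[y yw /and3P[xy sx sy]]]] :=
  check (s 0%N) (s 1%N) (s 2%N) (s 3%N) (s 4%N) (s 5%N) (s 6%N) (s 7%N) (s 8%N) (s 9%N)
  ltac:(by rewrite -[RHS]s5 -(big_mkord xpredT (fun i => nat_of_bool (s i))) unlock).
have small k : (k < 10)%N ->
  nth false [:: s 0%N; s 1%N; s 2%N; s 3%N; s 4%N; s 5%N; s 6%N; s 7%N; s 8%N; s 9%N] k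
  = s k.
  by do 10!(case: k => [//|k]).
have nbr10 k : k \in petersen_nbr w -> (k < 10)%N by rewrite mem_filter mem_iota => /andP[].
move: w10; rewrite mem_iota => /= w10.
exists w, x, y; split=> //; split.
  by move/eqP: sx; rewrite (small x) ?(small w) // nbr10.
by move/eqP: sy; rewrite (small y) ?(small w) // nbr10.
Qed.


Section PetersenFlow.
Variable R : realType.
Local Notation circ := (@to_circle R).
Local Notation C := (circle R).
Local Notation mid := (open_arc (circ 1) (circ 4)).

Lemma three_terms (f : nat -> R) (l : seq nat) (x : nat) : size l = 3%N -> x \in l ->
  (forall y, y \in l -> 1 < f y < 4) -> f x + 2 < \sum_(y <- l) f y < f x + 8.
Proof.
case: l => [|a [|b [|c []]]] // _ xl h.
have := h a; have := h b; have := h c.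
rewrite !big_cons big_nil !inE !eqxx ?orbT => /(_ isT) hc /(_ isT) hb /(_ isT) ha.
by move: xl; rewrite !inE => /or3P[] /eqP ->; lra.
Qed.

Lemma three_terms2 (f : nat -> R) (l : seq nat) (x y : nat) : size l = 3%N ->
  x \in l -> y \in l -> x != y ->
  exists2 z, z \in l & \sum_(y <- l) f y = f x + f y + f z.
Proof.
case: l => [|a [|b [|c []]]] // _.
rewrite !inE => /or3P[] /eqP -> /or3P[] /eqP -> //; rewrite ?eqxx // => _;
  rewrite !big_cons big_nil.
all: by [exists a; rewrite ?inE ?eqxx ?orbT //; ring |
         exists b; rewrite ?inE ?eqxx ?orbT //; ring |
         exists c; rewrite ?inE ?eqxx ?orbT //; ring].
Qed.

(** [half v x] is the value leaving [v] along the edge to [x], taken in (1,4):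
    [half v x + half x v = 5].  If the three values leaving [v] sum to 5, each
    is less than 3, and if they sum to 10, each is more than 2.  So two
    neighbours of [w] of the kind of [w] send it less than 3 each, leaving more
    than 2 + 2 + 1 to leave [w] when 5 should, and symmetrically for 10. *)
Lemma petersen_no_flow (t : nat -> R) :
  (forall i, (i < 15)%N -> 1 < t i < 4) ->
  ~ (forall v, exists k : int, \sum_(i < 15)
     (t i *+ (v == (nth (0, 1)%N petersen i).1) - t i *+ (v == (nth (0, 1)%N petersen i).2))
     = 5 * k%:~R).
Proof.
move=> t14 tdiv.
pose half v x := if (v, x) \in petersen then t (index (v, x) petersen)
  else 5 - t (index (x, v) petersen).
have nbr3 v : (v < 10)%N -> size (petersen_nbr v) = 3%N.
  by do 10!(case: v => [//|v]).
have nbr_sym v x : (v < 10)%N -> x \in petersen_nbr v ->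
    (x < 10)%N /\ v \in petersen_nbr x.
  move=> v10; rewrite !mem_filter !mem_iota /= => /andP[xv x10].
  by rewrite v10 andbT orbC.
have half_opp v x : (v < 10)%N -> x \in petersen_nbr v -> half x v = 5 - half v x.
  rewrite /half mem_filter => v10 /andP[+ _].
  have /allP simple : all (fun e => (e.2, e.1) \notin petersen) petersen by [].
  case vx: ((v, x) \in petersen); last by rewrite orFb => ->; ring.
  move=> _.
  by have /negbTE -> : (x, v) \notin petersen := simple _ vx.
have half14 v x : (v < 10)%N -> x \in petersen_nbr v -> 1 < half v x < 4.
  rewrite /half mem_filter => v10 /andP[].
  case: ifP => [vx _ _|_ /= xv _]; first by apply: t14; rewrite -[15%N]/(size petersen) index_mem.
  have := t14 (index (x, v) petersen); rewrite -[15%N]/(size petersen) index_mem => /(_ xv).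
  lra.
have half_div v : (v < 10)%N -> exists k : int, \sum_(x <- petersen_nbr v) half v x = 5 * k%:~R.
  move=> v10; have [k tk] := tdiv v.
  exists (k + (count (fun e => e.2 == v) petersen)%:Z).
  rewrite intrD mulrDr -{}tk -pmulrn.
  rewrite -(big_mkord xpredT (fun i => t i *+ (v == (nth (0, 1)%N petersen i).1) -
    t i *+ (v == (nth (0, 1)%N petersen i).2))).
  move: v10; rewrite /half; do 10!(case: v => [_|v]; first by
    rewrite !unlock /=; ring).
  by [].
have total : \sum_(v < 10) \sum_(x <- petersen_nbr v) half v x = 75.
  rewrite -(big_mkord xpredT (fun v => \sum_(x <- petersen_nbr v) half v x)).
  rewrite /half !unlock /=; ring.
(* The kind of a vertex: [false] when the sum is 5, [true] when it is 10. *)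
have typ v : exists b : bool, (v < 10)%N -> \sum_(x <- petersen_nbr v) half v x = 5 + 5 * b%:R.
  have [v10|_] := boolP (v < 10)%N; last by exists false.
  have [k ks] := half_div v v10; rewrite ks.
  have : exists2 x, x \in petersen_nbr v & True.
    by have := nbr3 v v10; case: (petersen_nbr v) => [//|x l _]; exists x; rewrite ?inE ?eqxx.
  case=> x xv _; have := three_terms (nbr3 v v10) xv (fun y => half14 v y v10).
  have := half14 v x v10 xv; rewrite ks => h1 h2.
  have k0 : (0 < k)%R by rewrite -(ltr_int R); lra.
  have k3 : (k < 3)%R by rewrite -(ltr_int R); lra.
  have [->|->] : k = 1 \/ k = 2 by lia.
    by exists false => _ /=; ring.
  by exists true => _ /=; ring.
have [s sP] := choice typ.
have s5 : (\sum_(v < 10) s v = 5)%N.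
  have := total; rewrite (eq_bigr (fun v : 'I_10 => 5 + 5 * (s v)%:R)); last first.
    by move=> v _; apply: sP.
  rewrite big_split /= sumr_const card_ord -mulr_sumr -natr_sum => h.
  by apply/eqP; rewrite -(eqr_nat R); apply/eqP; lra.
have [w [x [y [w10 xw yw xy [sx sy]]]]] := petersen_balanced s5.
have [x10 wx] := nbr_sym w x w10 xw; have [y10 wy] := nbr_sym w y w10 yw.
have bx := three_terms (nbr3 x x10) wx (fun y => half14 x y x10).
have b_y := three_terms (nbr3 y y10) wy (fun x => half14 y x y10).
have [z zw hz] := three_terms2 (half w) (nbr3 w w10) xw yw xy.
have := half14 w z w10 zw; have := half_opp w x w10 xw; have := half_opp w y w10 yw.
move: bx b_y hz; rewrite !sP // sx sy.
move: (half w x) (half w y) (half w z) (half x w) (half y w) => p q r p' q'.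
by case: (s w) => /=; lra.
Qed.
End PetersenFlow.

(** * Series, parallel and bridge compositions *)

Section Gadgets.
Variable R : realType.
Local Notation circ := (@to_circle R).
Local Notation C := (circle R).
Local Notation mid := (open_arc (circ 1) (circ 4)).

(** Multiples of 1/8 are fine enough to hold a witness for every cell below, and
    reduce the verification of a flow to integers modulo 40. *)
Definition pt (n : int) : C := circ (n%:~R / 8).

Lemma ptD m n : pt (m + n) = pt m + pt n.
Proof. by rewrite /pt intrD mulrDl to_circleD. Qed.

Lemma ptN n : pt (- n) = - pt n.
Proof. by rewrite /pt mulrNz mulNr to_circleN. Qed.

Lemma pt_eq m n : (m = n %[mod 40])%Z -> pt m = pt n.
Proof.
move/eqP; rewrite eqz_mod_dvd => /dvdzP[k mnk]; apply/to_circle_eq; exists k.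
have -> : m = n + k * 40 by lia.
by rewrite intrD intrM; field.
Qed.

Lemma pt0 : pt 0 = 0.
Proof. by rewrite /pt mul0r to_circle0. Qed.

Lemma mid_pt (n : int) : 8 < n < 32 -> mid (pt n).
Proof.
move=> /andP[n8 n32]; apply/midP; exists (n%:~R / 8) => //.
have : (8%:~R < n%:~R :> R) by rewrite ltr_int.
have : (n%:~R < 32%:~R :> R) by rewrite ltr_int.
lra.
Qed.

Let carryE := (@mulr1n C, @mulr0n C, @subr0 C, @sub0r C, @oppr0 C, @add0r C, @addr0 C, @opprK C).

Lemma carry_split (u x w : nat) (a : C) v : carry u w a v = carry u x a v + carry x w a v.
Proof. by rewrite /carry addrA subrK. Qed.

Lemma net_graphic_mid : net_graphic mid.
Proof.
exists [:: (0, 1)]%N => //; apply/seteqP; split=> z /=.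
  by exists z => // v; rewrite subrr.
case=> a amid /(_ 0%N); rewrite /carry /= !carryE => /eqP.
by rewrite subr_eq0 => /eqP ->.
Qed.

Lemma net_graphic_series (A B : set C) :
  net_graphic A -> net_graphic B -> net_graphic (A `&` B).
Proof.
move=> gA gB.
suff -> : A `&` B = capacity [:: (0, 2, A); (2, 1, B)]%N.
  by apply: (@net_graphic_capacity _ 3) => // x [<-|[<-|[]]].
apply/seteqP; split=> z /=.
  case=> Az Bz; exists z => //; exists z => // v.
  by rewrite (carry_split 0 2 1) -addrA -opprD subrr.
case=> a Aa [b Bb h].
have := h 0%N; rewrite /carry /= !carryE => /eqP; rewrite subr_eq0 => /eqP ->.
have := h 2%N; rewrite /carry /= !carryE => /eqP.
by rewrite subr_eq0 => /eqP ab; rewrite {2}ab.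
Qed.

Definition sumset (A B : set C) : set C :=
  [set z | exists2 a, A a & exists2 b, B b & z = a + b].

Lemma net_graphic_parallel (A B : set C) :
  net_graphic A -> net_graphic B -> net_graphic (sumset A B).
Proof.
move=> gA gB.
suff -> : sumset A B = capacity [:: (0, 1, A); (0, 1, B)]%N.
  by apply: (@net_graphic_capacity _ 2) => // x [<-|[<-|[]]].
apply/seteqP; split=> z /= [a Aa [b Bb h]]; exists a => //; exists b => //.
  by move=> v; rewrite h carryD -addrA -opprD subrr.
have := h 0%N; rewrite /carry /= !carryE => /eqP; rewrite subr_eq0 subr_eq => /eqP ->.
exact: addrC.
Qed.

(** The complete graph on four vertices without the edge between the terminals:
    two paths [a1, a2] and [a3, a4] joined by [a5]. *)
Definition bridge (A1 A2 A3 A4 A5 : set C) : set C :=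
  [set z | exists a1 a2 a3 a4 a5, [/\ A1 a1 /\ A2 a2, A3 a3 /\ A4 a4, A5 a5,
     z = a1 + a3 & a1 = a2 + a5 /\ a4 = a3 + a5]].

Lemma net_graphic_bridge (A1 A2 A3 A4 A5 : set C) :
  net_graphic A1 -> net_graphic A2 -> net_graphic A3 -> net_graphic A4 ->
  net_graphic A5 -> net_graphic (bridge A1 A2 A3 A4 A5).
Proof.
move=> g1 g2 g3 g4 g5.
suff -> : bridge A1 A2 A3 A4 A5 =
    capacity [:: (0, 2, A1); (2, 1, A2); (0, 3, A3); (3, 1, A4); (2, 3, A5)]%N.
  by apply: (@net_graphic_capacity _ 4) => // x [<-|[<-|[<-|[<-|[<-|[]]]]]].
apply/seteqP; split=> z.
  case=> a1 [a2 [a3 [a4 [a5 [[? ?] [? ?] ? zE [a1E a4E]]]]]]; subst z a1 a4.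
  exists (a2 + a5) => //; exists a2 => //; exists a3 => //; exists (a3 + a5) => //.
  exists a5 => // v; rewrite !carryD (carry_split 0 2 1 a2) (carry_split 0 3 1 a3).
  rewrite (carry_split 0 2 1 a5) (carry_split 2 3 1 a5).
  apply/eqP; rewrite !subr_eq add0r; apply/eqP.
  by rewrite [LHS](AC ((2*(1*2))*2) (((4*(7*5))*6)*2*(1*3))).
case=> a1 ? [a2 ? [a3 ? [a4 ? [a5 ? h]]]].
exists a1, a2, a3, a4, a5; split=> //.
  have := h 0%N; rewrite /carry /= !carryE => /eqP.
  by rewrite subr_eq0 subr_eq addrC => /eqP.
split.
  have := h 2%N; rewrite /carry /= !carryE => /eqP.
  by rewrite subr_eq0 subr_eq addrC => /eqP.
have := h 3%N; rewrite /carry /= !carryE => /eqP.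
by rewrite addrAC subr_eq0 => /eqP.
Qed.

(** This is the arc (-1,1). *)
Definition petersen_cap : set C := capacity (plain R (take 14 petersen)).

Lemma net_graphic_petersen : net_graphic petersen_cap.
Proof. by exists (take 14 petersen). Qed.

(** [carry], [net] with numerators over 8; [grid_rest] is what remains of the
    divergence [d] at [v] once the values [ns] are carried along [L]. *)
Definition grid_carry (u w : nat) (n : int) (v : nat) : int :=
  (if v == u then n else 0) - (if v == w then n else 0).

Lemma carry_pt (u w : nat) (n : int) v : carry u w (pt n) v = pt (grid_carry u w n v).
Proof.
by rewrite /carry /grid_carry ptD ptN; case: (v == u); case: (v == w);
  rewrite ?pt0.
Qed.

Fixpoint grid_rest (L : seq (nat * nat)) (ns : seq int) (d : int) (v : nat) : int :=
  match L, ns with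
  | e :: L', n :: ns' => grid_rest L' ns' (d - grid_carry e.1 e.2 n v) v
  | _, _ => d
  end.

Lemma grid_carry_out u w n v : (v == u) = false -> (v == w) = false ->
  grid_carry u w n v = 0.
Proof. by rewrite /grid_carry => -> ->. Qed.

Lemma grid_rest_out L ns d v : all (fun e => (v != e.1) && (v != e.2)) L ->
  grid_rest L ns d v = d.
Proof.
elim: L ns d => [|e L IH] [|n ns] d //= /andP[/andP[/negbTE v1 /negbTE v2] vL].
by rewrite IH // grid_carry_out // subr0.
Qed.

Lemma grid_flow (L : seq (nat * nat)) (ns : seq int) (d : nat -> int) :
  size ns = size L -> all (fun n => 8 < n < 32) ns ->
  (forall v, (40 %| grid_rest L ns (d v) v)%Z) -> net (plain R L) (fun v => pt (d v)).
Proof.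
elim: L ns d => [|[u w] L IH] [|n ns] d //=.
  move=> _ _ h v; rewrite -pt0; apply: pt_eq; apply/eqP.
  by rewrite eqz_mod_dvd subr0.
case=> sz /andP[n14 all14] h; exists (pt n); first exact: mid_pt.
by apply: net_ext (IH _ _ sz all14 h) => v; rewrite ptD ptN carry_pt.
Qed.

Lemma petersen_cap_pt (z : int) (ns : seq int) : size ns = 14%N ->
  all (fun n => 8 < n < 32) ns ->
  all (fun v => (40 %| grid_rest (take 14 petersen) ns (grid_carry 0 1 z v) v)%Z) (iota 0 10) ->
  petersen_cap (pt z).
Proof.
move=> sz ns14 /allP h.
suff: net (plain R (take 14 petersen)) (carry 0 1 (pt z)) by [].
apply: (net_ext (d := fun v => pt (grid_carry 0 1 z v))) => [v|]; first by rewrite carry_pt.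
apply: (@grid_flow _ ns (grid_carry 0 1 z)) => // v.
have [v10|v10] := ltnP v 10; first by apply: h; rewrite mem_iota.
rewrite grid_rest_out; first by rewrite grid_carry_out // gtn_eqF //; apply: leq_trans v10.
have : all (fun e => (e.1 < 10)%N && (e.2 < 10)%N) (take 14 petersen) by [].
by apply: sub_all => e /andP[e1 e2]; rewrite !gtn_eqF //; apply: leq_trans v10.
Qed.

Lemma petersen_cap_0 : petersen_cap (pt 0).
Proof.
exact: (@petersen_cap_pt 0 [:: 31; 22; 31; 9; 9; 9; 9; 31; 22; 18; 18; 27; 9; 9]).
Qed.

Lemma petersen_cap_4 : petersen_cap (pt 4).
Proof.
exact: (@petersen_cap_pt 4 [:: 27; 18; 27; 9; 13; 9; 9; 31; 18; 22; 18; 31; 9; 9]).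
Qed.

Lemma petersen_cap_SI5 : SI5 R petersen_cap.
Proof.
apply: net_graphic_SI5 net_graphic_petersen _; exists (pt 4); first exact: petersen_cap_4.
rewrite -pt0; apply/eqP => /to_circle_eq[k hk].
have k1 : (0 < k)%R by rewrite -(ltr_int R); lra.
have k2 : (k < 1)%R by rewrite -(ltr_int R); lra.
lia.
Qed.

(** A value in (1,4) would extend the flow to the edge between the terminals. *)
Lemma petersen_cap_mid (z : C) : petersen_cap z -> ~ mid z.
Proof.
move=> /net_sum[a [amid aE]] zmid.
have /choice[t tP] i : exists t : R, (i < 15)%N ->
    1 < t < 4 /\ circ t = if (i < 14)%N then a i else z.
  have [i14|i14] := ltnP i 14; last by have /midP[t t14 tz] := zmid; exists t.
  have := amid i; rewrite size_map => /(_ i14).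
  rewrite (nth_map (0, 1)%N) // => /midP[t t14 ta].
  by exists t.
apply: (@petersen_no_flow R t) => [i i15|v]; first by case: (tP i i15).
suff : circ (\sum_(i < 15) (t i *+ (v == (nth (0, 1)%N petersen i).1) -
    t i *+ (v == (nth (0, 1)%N petersen i).2))) = circ 0.
  by move/to_circle_eq => [k ->]; exists k; rewrite add0r.
rewrite (big_morph _ (@to_circleD R) (to_circle0 R)) to_circle0 big_ord_recr /=.
have carry_circ u w (x : R) : circ (x *+ (v == u) - x *+ (v == w)) = carry u w (circ x) v.
  by rewrite to_circleD to_circleN /carry; case: (v == u); case: (v == w);
    rewrite /= ?mulr0n ?to_circle0.
rewrite carry_circ (proj2 (tP 14%N isT)) /=.
transitivity (carry 0 1 z v + carry 1 0 z v); last by rewrite /carry addrA subrK subrr.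
congr (_ + _); rewrite aE size_map; apply: eq_bigr => i _.
rewrite carry_circ (proj2 (tP i _)); last by apply: ltn_trans (ltn_ord i) _.
by have i14 := ltn_ord i; rewrite i14 (nth_map (0, 1)%N) // nth_take.
Qed.

End Gadgets.

(** * Sets that separate the sample points *)

Section Generators.
Variable R : realType.
Local Notation circ := (@to_circle R).
Local Notation C := (circle R).
Local Notation mid := (open_arc (circ 1) (circ 4)).
Local Notation pt := (pt R).
Local Notation D := (@petersen_cap R).

Lemma cellmate_pt (i n : int) : 8 * (i - 1) < n < 8 * (i + 1) ->
  cellmate ((8 * i)%:~R / 8 : R) (n%:~R / 8).
Proof.
move=> /andP[]; rewrite -!(ltr_int R) !intrM intrB intrD => n1 n2.
by exists i; right; split; [field | apply/andP; split; lra].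
Qed.

Lemma SI5_pt (X : set C) (i n : int) : SI5 R X -> 8 * (i - 1) < n < 8 * (i + 1) ->
  X (pt (8 * i)) -> X (pt n).
Proof. by move=> /SI5P[_ cX] h; apply: cX; apply: cellmate_pt. Qed.

Lemma SI5N (X : set C) z : SI5 R X -> X z -> X (- z).
Proof. by case=> symX _ /symX. Qed.

Lemma pt_neq0 (n : int) : 0 < n < 40 -> pt n != 0.
Proof.
move=> n40; rewrite -(pt0 R); apply/eqP => /to_circle_eq[k hk].
have : (n = 40 * k)%R.
  by apply/eqP; rewrite -(eqr_int R) intrM; apply/eqP; lra.
lia.
Qed.

Lemma petersen_cap_pt_lt (n : int) : -8 < n < 8 -> D (pt n).
Proof.
move=> n8; apply: (@SI5_pt _ 0 n (petersen_cap_SI5 R)); first lia.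
exact: petersen_cap_0.
Qed.

(** The points outside [-1,1] are excluded by [petersen_cap_mid]; 1 and -1 would
    bring 3/2 and -3/2 along with them. *)
Lemma petersen_cap_lift (z : C) : D z -> exists2 t, -1 < t < 1 & circ t = z.
Proof.
have [t [<- t1 t2]] := to_circle_centred z => Dt.
have [_ cD] := iffLR (SI5P _) (petersen_cap_SI5 R).
have out s : 1 < s < 4 -> ~ D (circ s).
  by move=> s14 Ds; apply: (petersen_cap_mid Ds); apply/midP; exists s.
have shift s : circ s = circ (s + 5) by apply/to_circle_eq; exists (-1); ring.
exists t => //; apply/andP; split; rewrite ltNge; apply/negP.
  rewrite le_eqVlt => /orP[/eqP tE|tlt]; last by apply: (out (t + 5)); [lra|rewrite -shift].
  apply: (out (- (3 / 2) + 5)); first lra.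
  by rewrite -shift; apply: cD Dt; exists (-1); right; split; lra.
rewrite le_eqVlt => /orP[/eqP tE|tlt]; last by apply: (out t) => //; lra.
apply: (out (3 / 2)); first lra.
by apply: cD Dt; exists 1; right; split; lra.
Qed.

(** This is the arc (-2,2). *)
Definition cap_lt2 : set C := sumset D D.
(** This is (1,2) u (3,4). *)
Definition cap_12 : set C := mid `&` cap_lt2.

(** Both summands are rounded halves of [n]; at [n = 15] one would reach 8. *)
Lemma cap_lt2_pt (n : int) : -15 < n < 15 -> cap_lt2 (pt n).
Proof.
move=> n16.
have [q [q8 nq8]] : exists q : int, -8 < q < 8 /\ -8 < n - q < 8.
  exists (n %/ 2)%Z; have := divz_eq n 2.
  have : 0 <= (n %% 2)%Z by apply: modz_ge0.
  have : (n %% 2)%Z < 2 by apply: ltz_pmod.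
  by move: (n %/ 2)%Z (n %% 2)%Z => q r; lia.
exists (pt q); first exact: petersen_cap_pt_lt.
exists (pt (n - q)); first exact: petersen_cap_pt_lt.
by rewrite -ptD addrC subrK.
Qed.

Lemma cap_lt2_lift (z : C) : cap_lt2 z -> exists2 t, -2 < t < 2 & circ t = z.
Proof.
case=> a /petersen_cap_lift[s s1 <-] [b /petersen_cap_lift[t t1 <-] ->].
by exists (s + t); [lra|rewrite to_circleD].
Qed.

Lemma cap_12_pt (n : int) : (8 < n < 15) || (25 < n < 32) -> cap_12 (pt n).
Proof.
move=> n8; split; first by apply: mid_pt; lia.
have [n16|n16] := ltP n 16; first by apply: cap_lt2_pt; lia.
have -> : pt n = pt (n - 40) by apply: pt_eq; lia.
by apply: cap_lt2_pt; lia.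
Qed.

Lemma cap_12_lift (z : C) : cap_12 z ->
  exists2 t, 1 < t < 2 \/ 3 < t < 4 & circ t = z.
Proof.
case=> /midP[t t14 tz] /cap_lt2_lift[s s2]; rewrite -tz => /to_circle_eq[k sk].
exists t => //.
have k1 : (-2 < k)%R by rewrite -(ltr_int R); lra.
have k2 : (k < 1)%R by rewrite -(ltr_int R); lra.
have [kE|kE] : k = 0 \/ k = -1 by lia.
  by move: sk; rewrite kE mulr0z => sk; left; lra.
by move: sk; rewrite kE mulrN1z => sk; right; lra.
Qed.

Lemma bridge_core (t1 t2 t5 : R) : -1 < t1 - t2 < 1 -> 1 < t5 < 4 ->
  circ t1 <> circ t2 + circ t5.
Proof.
move=> h12 h5; rewrite -to_circleD => /to_circle_eq[k hk].
have k1 : (-1 < k)%R by rewrite -(ltr_int R); lra.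
have k2 : (k < 0)%R by rewrite -(ltr_int R); lra.
lia.
Qed.

Lemma bridge_pt (A1 A2 A3 A4 A5 : set C) (n n1 n2 n3 n4 n5 : int) :
  A1 (pt n1) -> A2 (pt n2) -> A3 (pt n3) -> A4 (pt n4) -> A5 (pt n5) ->
  (n = n1 + n3 %[mod 40])%Z -> (n1 = n2 + n5 %[mod 40])%Z -> (n4 = n3 + n5 %[mod 40])%Z ->
  bridge A1 A2 A3 A4 A5 (pt n).
Proof.
move=> h1 h2 h3 h4 h5 e1 e2 e3.
exists (pt n1), (pt n2), (pt n3), (pt n4), (pt n5).
by split; [split|split| |rewrite -ptD; apply: pt_eq|split; rewrite -ptD; apply: pt_eq].
Qed.

(** This is the complement of 2 and -2. *)
Definition cap_neq2 : set C := bridge mid mid mid mid mid.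
(** This is (-1,1) u (2,3). *)
Definition cap_23_lt1 : set C := bridge mid mid cap_12 cap_12 mid.

Lemma bridgeE (A1 A2 A3 A4 A5 : set C) z : bridge A1 A2 A3 A4 A5 z ->
  exists a1 a2 a3 a4 a5, [/\ A1 a1 /\ A2 a2, A3 a3 /\ A4 a4, A5 a5,
   a1 + a3 = z /\ a2 + a4 = z & a1 = a2 + a5].
Proof.
case=> a1 [a2 [a3 [a4 [a5 [h12 h34 h5 zE [a1E a4E]]]]]].
exists a1, a2, a3, a4, a5; split=> //; split=> //.
by rewrite zE a1E a4E addrCA addrA [a3 + _]addrC addrAC.
Qed.

(** At each terminal the two edges sum to 7, so each of them exceeds 3; then the
    edges [a1] and [a2] differ by less than 1, which [a5] cannot make up for. *)
Lemma cap_neq2_16 : ~ cap_neq2 (pt 16).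
Proof.
have big (s t : R) : 1 < s < 4 -> 1 < t < 4 -> circ s + circ t = pt 16 -> s + t = 7.
  move=> s14 t14; rewrite -to_circleD => /to_circle_eq[k hk].
  have k1 : (0 < k)%R by rewrite -(ltr_int R); lra.
  have k2 : (k < 2)%R by rewrite -(ltr_int R); lra.
  have kE : k = 1 by lia.
  by rewrite hk kE; field.
case/bridgeE => a1 [a2 [a3 [a4 [a5 [[m1 m2] [m3 m4] m5 [e13 e24]]]]]].
case/midP: m1 e13 => t1 h1 <-; case/midP: m2 e24 => t2 h2 <-.
case/midP: m3 => t3 h3 <-; case/midP: m4 => t4 h4 <-; case/midP: m5 => t5 h5 <-.
move=> e24 e13.
have := big _ _ h1 h3 e13; have := big _ _ h2 h4 e24 => s24 s13.
by apply: bridge_core => //; lra.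
Qed.

(** At each terminal the two edges sum to 13/2; the one in (1,2) u (3,4) must
    then exceed 5/2, hence 3, and the other lies in (5/2, 7/2). *)
Lemma cap_23_lt1_12 : ~ cap_23_lt1 (pt 12).
Proof.
have big (s t : R) : 1 < s < 4 -> (1 < t < 2 \/ 3 < t < 4) ->
    circ s + circ t = pt 12 -> 5 / 2 < s < 7 / 2.
  move=> s14 t14; rewrite -to_circleD => /to_circle_eq[k hk].
  have k1 : (0 < k)%R by rewrite -(ltr_int R); case: t14; lra.
  have k2 : (k < 2)%R by rewrite -(ltr_int R); case: t14; lra.
  have kE : k = 1 by lia.
  have {hk}hk : s + t = 13 / 2 by rewrite hk kE; field.
  by case: t14; lra.
case/bridgeE => a1 [a2 [a3 [a4 [a5 [[m1 m2] [m3 m4] m5 [e13 e24]]]]]].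
case/midP: m1 e13 => t1 h1 <-; case/midP: m2 e24 => t2 h2 <-.
case/cap_12_lift: m3 => t3 h3 <-; case/cap_12_lift: m4 => t4 h4 <-; case/midP: m5 => t5 h5 <-.
move=> e24 e13.
have := big _ _ h1 h3 e13; have := big _ _ h2 h4 e24 => s24 s13.
by apply: bridge_core => //; lra.
Qed.

Lemma SI5_of_pt (G : set C) (n : int) : net_graphic G -> 0 < n < 40 -> G (pt n) -> SI5 R G.
Proof. by move=> gG n40 Gn; apply: net_graphic_SI5 => //; exists (pt n) => //; apply: pt_neq0. Qed.

Lemma SI5_sample_pt (z : C) :
  exists2 j : nat, (j < 6)%N & forall X, SI5 R X -> X z <-> X (pt (4 * j)%N).
Proof.
have [j jP] := SI5_sample z; exists j => // X SX; rewrite (jP _ SX).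
suff -> : circ (sample R j) = pt (4 * j)%N by [].
by rewrite /sample; congr circ; rewrite -pmulrn natrM; field.
Qed.

(** [4 * k] is the numerator of the sample point [k / 2]. *)
Definition separates (k : nat) (G : set C) : Prop := net_graphic G /\
  ~ G (pt (4 * k)%N) /\ forall X, SI5 R X -> ~ X (pt (4 * k)%N) -> X `<=` G.

(** An even [j] stands for an integer point, and a member of SI5 that contains
    it contains the two adjacent unit cells, hence the sample point [k] when
    [k] is next to [j].  The other sample points have to be checked to lie in
    [G]; the point [pt n] makes [G] a member of SI5. *)
Lemma separates_intro (k n : nat) (G : set C) : net_graphic G -> (0 < n < 40)%N ->
  G (pt n) -> ~ G (pt (4 * k)%N) ->
  (forall j, (j < 6)%N -> j != k -> [|| odd j, (j.+1 < k)%N | (k.+1 < j)%N] ->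
    G (pt (4 * j)%N)) -> separates k G.
Proof.
move=> gG n40 Gn Gk Gj; split=> //; split=> // X SX Xk z Xz.
have SG : SI5 R G by apply: SI5_of_pt Gn.
have [j j6 jP] := SI5_sample_pt z; rewrite (jP _ SG); move: Xz; rewrite (jP _ SX) => Xj.
have [jk|jk] := eqVneq j k; first by rewrite jk in Xj.
have [far|] := boolP [|| odd j, (j.+1 < k)%N | (k.+1 < j)%N]; first exact: Gj.
rewrite !negb_or -!leqNgt => /and3P[jeven kj jk'].
case: Xk; apply: (@SI5_pt X j./2 _ SX).
  by move: (odd_double_half j); rewrite (negbTE jeven); lia.
suff -> : (8 * j./2%:Z)%R = (4 * j)%N :> int by [].
by move: (odd_double_half j); rewrite (negbTE jeven); lia.
Qed.

Lemma below6 (P : nat -> Prop) : P 0%N -> P 1%N -> P 2%N -> P 3%N -> P 4%N -> P 5%N ->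
  forall j, (j < 6)%N -> P j.
Proof. by move=> p0 p1 p2 p3 p4 p5 [|[|[|[|[|[|]]]]]]. Qed.

Let mid_graphic := net_graphic_mid R.
Let D_graphic := net_graphic_petersen R.

Lemma cap_lt2_graphic : net_graphic cap_lt2.
Proof. exact: net_graphic_parallel. Qed.

Lemma cap_12_graphic : net_graphic cap_12.
Proof. exact: net_graphic_series mid_graphic cap_lt2_graphic. Qed.

Lemma separates0 : separates 0 (sumset mid D).
Proof.
have in_sum m n : 8 < m < 32 -> -8 < n < 8 -> sumset mid D (pt (m + n)).
  move=> hm hn; exists (pt m); first exact: mid_pt.
  by exists (pt n); [exact: petersen_cap_pt_lt|exact: ptD].
apply: (@separates_intro 0 20) => //; first exact: net_graphic_parallel.
- exact: (in_sum 20 0).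
- case=> a amid [d Dd]; rewrite muln0 pt0 => /eqP; rewrite eq_sym addr_eq0 => /eqP ad.
  by apply: (petersen_cap_mid (SI5N (petersen_cap_SI5 R) Dd)); rewrite -ad.
- apply: below6 => // _ _.
  + exact: (in_sum 10 (-6)).
  + exact: (in_sum 12 (-4)).
  + exact: (in_sum 12 0).
  + exact: (in_sum 16 0).
  + exact: (in_sum 20 0).
Qed.

Lemma separates1 : separates 1 mid.
Proof.
apply: (@separates_intro 1 20) => //; first exact: mid_pt.
- case/midP => t t14 /to_circle_eq[k hk].
  have k1 : (0 < k)%R by rewrite -(ltr_int R); lra.
  have k2 : (k < 1)%R by rewrite -(ltr_int R); lra.
  lia.
- by apply: below6 => // _ _; apply: mid_pt.
Qed.

Lemma separates5 : separates 5 cap_lt2.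
Proof.
apply: (@separates_intro 5 4) => //; first exact: cap_lt2_graphic.
- exact: cap_lt2_pt.
- case/cap_lt2_lift => t t2 /to_circle_eq[k hk].
  have k1 : (-1 < k)%R by rewrite -(ltr_int R); lra.
  have k2 : (k < 0)%R by rewrite -(ltr_int R); lra.
  lia.
- by move=> j j6 j5 h; apply: cap_lt2_pt; lia.
Qed.

Lemma separates2 : separates 2 (sumset cap_12 cap_12).
Proof.
have in_sum m n : (8 < m < 15) || (25 < m < 32) -> (8 < n < 15) || (25 < n < 32) ->
    sumset cap_12 cap_12 (pt (m + n)).
  move=> hm hn; exists (pt m); first exact: cap_12_pt.
  by exists (pt n); [exact: cap_12_pt|exact: ptD].
have wrap m n : (m = n %[mod 40])%Z -> sumset cap_12 cap_12 (pt m) -> sumset cap_12 cap_12 (pt n).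
  by move/pt_eq => ->.
apply: (@separates_intro 2 20) => //.
- exact: net_graphic_parallel cap_12_graphic cap_12_graphic.
- exact: (in_sum 10 10).
- case=> a /cap_12_lift[s hs <-] [b /cap_12_lift[t ht <-]].
  rewrite -to_circleD => /to_circle_eq[k hk].
  have k1 : (-2 < k)%R by rewrite -(ltr_int R); case: hs; case: ht; lra.
  have k2 : (k < 0)%R by rewrite -(ltr_int R); case: hs; case: ht; lra.
  have kE : k = -1 by lia.
  by move: hk; rewrite kE mulrN1z; case: hs; case: ht; lra.
- apply: below6 => // _ _.
  + exact: (wrap _ _ _ (in_sum 12 28 _ _)).
  + exact: (wrap _ _ _ (in_sum 14 30 _ _)).
  + exact: (wrap _ _ _ (in_sum 26 26 _ _)).
  + exact: (wrap _ _ _ (in_sum 28 28 _ _)).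
  + exact: (in_sum 10 10).
Qed.

Lemma separates3 : separates 3 cap_23_lt1.
Proof.
have in_cap n n1 n2 n3 n4 n5 :
    [&& 8 < n1 < 32, 8 < n2 < 32 & 8 < n5 < 32] ->
    ((8 < n3 < 15) || (25 < n3 < 32)) && ((8 < n4 < 15) || (25 < n4 < 32)) ->
    (n = n1 + n3 %[mod 40])%Z -> (n1 = n2 + n5 %[mod 40])%Z -> (n4 = n3 + n5 %[mod 40])%Z ->
    cap_23_lt1 (pt n).
  move=> /and3P[h1 h2 h5] /andP[h3 h4]; apply: bridge_pt;
    by [apply: mid_pt | apply: cap_12_pt].
apply: (@separates_intro 3 20) => //.
- exact: net_graphic_bridge cap_12_graphic cap_12_graphic _.
- exact: (in_cap _ 10 30 10 30 20).
- exact: cap_23_lt1_12.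
- apply: below6 => // _ _.
  + exact: (in_cap _ 28 14 12 26 14).
  + exact: (in_cap _ 30 16 14 28 14).
  + exact: (in_cap _ 10 30 10 30 20).
Qed.

Lemma separates4 : separates 4 cap_neq2.
Proof.
have in_cap n n1 n2 n3 n4 n5 :
    all (fun m => 8 < m < 32) [:: n1; n2; n3; n4; n5] ->
    (n = n1 + n3 %[mod 40])%Z -> (n1 = n2 + n5 %[mod 40])%Z -> (n4 = n3 + n5 %[mod 40])%Z ->
    cap_neq2 (pt n).
  by rewrite /= andbT => /and5P[h1 h2 h3 h4 h5]; apply: bridge_pt; apply: mid_pt.
apply: (@separates_intro 4 20) => //.
- exact: net_graphic_bridge.
- exact: (in_cap _ 10 30 10 30 20).
- exact: cap_neq2_16.
- apply: below6 => // _ _.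
  + exact: (in_cap _ 28 14 12 26 14).
  + exact: (in_cap _ 28 14 16 30 14).
  + exact: (in_cap _ 28 18 20 30 10).
  + exact: (in_cap _ 30 21 22 31 9).
  + exact: (in_cap _ 10 30 10 30 20).
Qed.

Lemma separator (k : nat) : (k < 6)%N -> exists G, separates k G.
Proof.
case: k => [_|[_|[_|[_|[_|[_|//]]]]]]; eexists.
- exact: separates0.
- exact: separates1.
- exact: separates2.
- exact: separates3.
- exact: separates4.
- exact: separates5.
Qed.

Lemma full_graphic : net_graphic [set: C].
Proof.
have <- : sumset mid mid = [set: C]; last exact: net_graphic_parallel.
apply/seteqP; split=> z // _; have [t [<- t1 t2]] := to_circle_centred z.
have half : mid (circ ((t + 5) / 2)) by apply/midP; exists ((t + 5) / 2) => //; lra.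
exists (circ ((t + 5) / 2)) => //; exists (circ ((t + 5) / 2)) => //.
by rewrite -to_circleD; apply/to_circle_eq; exists (-1); field.
Qed.

(** Intersecting the separating sets of the sample points outside [A] gives a
    set of SI5 with the same sample points as [A].  The empty set has no
    nonzero point and is treated apart. *)
Theorem SI5_graphic (A : set C) : SI5 R A -> net_graphic A.
Proof.
move=> SA.
have sep m : (m <= 6)%N -> exists X, [/\ net_graphic X, A `<=` X &
    forall k, (k < m)%N -> ~ A (pt (4 * k)%N) -> ~ X (pt (4 * k)%N)].
  elim: m => [|m IH] m6; first by exists setT; split=> //; exact: full_graphic.
  have [X [gX AX Xk]] := IH (ltnW m6).
  have [Am|nAm] := pselect (A (pt (4 * m)%N)).
    exists X; split=> // k; rewrite ltnS leq_eqVlt => /orP[/eqP ->|/Xk] //.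
  have [G [gG [Gm AG]]] := separator m6.
  exists (X `&` G); split; first exact: net_graphic_series.
    by move=> z Az; split; [exact: AX|exact: AG Az].
  by move=> k; rewrite ltnS leq_eqVlt => /orP[/eqP ->|/Xk h] nA [] // /(h nA).
have [X [gX AX Xk]] := sep 6 (leqnn 6).
have [[z Az]|A0] := pselect (exists z, A z); last first.
  suff -> : A = mid `&` D by exact: net_graphic_series.
  apply/seteqP; split=> z; first by move=> Az; case: A0; exists z.
  by case=> zmid /petersen_cap_mid.
suff [n n40 An] : exists2 n : int, 0 < n < 40 & A (pt n).
  have SX : SI5 R X by apply: SI5_of_pt n40 (AX _ An).
  suff -> : A = X by [].
  apply/seteqP; split=> // x; have [k k6 kP] := SI5_sample_pt x.
  by rewrite (kP _ SX) (kP _ SA); apply: contraPP => /(Xk _ k6).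
have [k k6 kP] := SI5_sample_pt z; move/(kP _ SA): Az.
case: k k6 {kP} => [|k] k6 Ak; last by exists (4 * k.+1)%N => //; lia.
by exists 4 => //; apply: (@SI5_pt A 0 4 SA) => //; move: Ak; rewrite muln0 mulr0.
Qed.

End Generators.

Theorem theorem2p15 (R : realType) :
  GI5 R = SI5 R /\
  (forall G : generalised_edge, terminals_joined G -> SI5 R (CP5 R G)).
Proof.
split; last exact: CP5_SI5.
apply/seteqP; split=> A; first by case.
by move=> SA; split=> //; apply: graphic_of_net; apply: SI5_graphic.
Qed.
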